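(* Let $0<\theta<1$ with $1/\theta\notin\mathbb Z$, and let $P=U^{-1}g+f+gU\in A^\infty_{1/\theta}$ be a Rieffel projection. Then the operator $$D=P\Bigl(x+\frac{d}{dx}\Bigr)P:\;P(S(\mathbb R))\longrightarrow P(S(\mathbb R))$$ on the Schwartz space $S(\mathbb R)$ of the real line is Fredholm and has index $$\operatorname{ind}D=\Bigl\{\frac1\theta\Bigr\}-\frac1\theta=-\Bigl[\frac1\theta\Bigr],$$ where $\{\cdot\}$ and $[\cdot]$ are the fractional and integer parts of a real number.
   Context: On functions on $\mathbb R$ with coordinate $x$ let $(Uf)(x)=f(x+1)$ and $(Vf)(x)=e^{-2\pi ix/\theta}f(x)$. $A^\infty_{1/\theta}$ is the algebra of operators $\sum_{j,k\in\mathbb Z}a_{jk}U^jV^k$ with rapidly decaying coefficients $a_{jk}\in\mathbb C$; it contains the operators of multiplication by smooth $\theta$-periodic functions. Rieffel projection: let $a=\theta\{1/\theta\}\in(0,\theta)$ be the representative of $1$ modulo $\theta$. Choose $\varepsilon>0$ so small that the arcs $[0,\varepsilon]$ and $[1,1+\varepsilon]$ of the circle $\mathbb R/\theta\mathbb Z$ are disjoint, i.e. $\varepsilon<a$ and $a+\varepsilon<\theta$. Let $f,g$ be smooth real $\theta$-periodic functions with $0\le f\le1$ such that $f=1$ on $[\varepsilon,a]$, $f=0$ on $[a+\varepsilon,\theta]$, $f(x)=1-f(x+1)$ for $x\in(0,\varepsilon)$; and $g=\sqrt{f-f^2}$ on $[0,\varepsilon]$, $g=0$ on $[\varepsilon,\theta]$.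 Then $P=U^{-1}g+f+gU$ is a projection in $A^\infty_{1/\theta}$. The index is $\dim\ker D-\dim\operatorname{coker}D$. *)

(* Defs.v *)
From Stdlib Require Import Reals ZArith.
From Coquelicot Require Import Coquelicot.
Open Scope R_scope.

(** * Schwartz space *)

(* [Derive] is only available for real-valued functions, hence the componentwise
   derivative of [phi : R -> C]; see [is_derive_CDerive]. *)
Definition CDerive (phi : R -> C) : R -> C :=
  fun x => (Derive (fun t => Re (phi t)) x, Derive (fun t => Im (phi t)) x).

Lemma is_derive_CDerive (phi : R -> C) (x : R) :
  ex_derive (V := C_R_NormedModule) phi x ->
  is_derive (V := C_R_NormedModule) phi x (CDerive phi x).
Proof.
intros [l Hl].
assert (H1 : is_derive (fun t => Re (phi t)) x (Re l)).
{ apply (filterdiff_comp' (V := C_R_NormedModule) phi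
           (fun z : C_R_NormedModule => (fst z : R_NormedModule)) x _
           (fun z : C_R_NormedModule => (fst z : R_NormedModule)) Hl).
  apply filterdiff_linear, (is_linear_fst (U := R_NormedModule) (V := R_NormedModule)). }
assert (H2 : is_derive (fun t => Im (phi t)) x (Im l)).
{ apply (filterdiff_comp' (V := C_R_NormedModule) phi
           (fun z : C_R_NormedModule => (snd z : R_NormedModule)) x _
           (fun z : C_R_NormedModule => (snd z : R_NormedModule)) Hl).
  apply filterdiff_linear, (is_linear_snd (U := R_NormedModule) (V := R_NormedModule)). }
assert (E : CDerive phi x = l).
{ destruct l as [l1 l2]; unfold CDerive; apply (f_equal2 pair).
  - exact (is_derive_unique _ _ _ H1).
  - exact (is_derive_unique _ _ _ H2). }
rewrite E; exact Hl.
Qed.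

Definition CDerive_n (n : nat) (phi : R -> C) : R -> C := Nat.iter n CDerive phi.

(* The seminorm [sup_x |x|^k |phi^(n)(x)|] is at most [B]. *)
Definition seminorm_le (k n : nat) (phi : R -> C) (B : R) : Prop :=
  forall x : R, Rabs x ^ k * Cmod (CDerive_n n phi x) <= B.

Definition schwartz (phi : R -> C) : Prop :=
  (forall (n : nat) (x : R),
      ex_derive (V := C_R_NormedModule) (CDerive_n n phi) x) /\
  (forall k n : nat, exists B : R, seminorm_le k n phi B).

(** * Fredholm operators between subspaces of the Schwartz space *)

Definition image (V : (R -> C) -> Prop) (T : (R -> C) -> (R -> C))
  (psi : R -> C) : Prop :=
  exists phi, V phi /\ forall x, psi x = T phi x.

Definition kernel (V : (R -> C) -> Prop) (T : (R -> C) -> (R -> C))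
  (phi : R -> C) : Prop :=
  V phi /\ forall x, T phi x = RtoC 0.

Definition zero_space (phi : R -> C) : Prop := forall x, phi x = RtoC 0.

(* [c 0 * e 0 + ... + c (n-1) * e (n-1)] *)
Fixpoint lincomb (n : nat) (c : nat -> C) (e : nat -> R -> C) (x : R) : C :=
  match n with
  | O => RtoC 0
  | S m => Cplus (lincomb m c e x) (Cmult (c m) (e m x))
  end.

(* The complex vector space [V / W] has dimension [n]: the classes of
   [e 0, ..., e (n-1)] form a basis. *)
Definition quotient_dim (V W : (R -> C) -> Prop) (n : nat) : Prop :=
  exists e : nat -> R -> C,
    (forall i, (i < n)%nat -> V (e i)) /\
    (forall phi, V phi ->
       exists c : nat -> C, W (fun x => Cminus (phi x) (lincomb n c e x))) /\
    (forall c : nat -> C, W (lincomb n c e) ->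
       forall i, (i < n)%nat -> c i = RtoC 0).

Definition ker_dim (V : (R -> C) -> Prop) (T : (R -> C) -> (R -> C)) (n : nat) :=
  quotient_dim (kernel V T) zero_space n.

Definition coker_dim (V W : (R -> C) -> Prop) (T : (R -> C) -> (R -> C)) (n : nat) :=
  quotient_dim W (image V T) n.

Definition linear_on (V : (R -> C) -> Prop) (T : (R -> C) -> (R -> C)) : Prop :=
  forall (c : C) (phi psi : R -> C), V phi -> V psi ->
    forall x, T (fun t => Cplus (Cmult c (phi t)) (psi t)) x
              = Cplus (Cmult c (T phi x)) (T psi x).

(* Continuity of a linear operator for the topology induced by the Schwartz space:
   each seminorm of [T phi] is bounded by a multiple of the maximum of finitely
   many seminorms of [phi]. *)
Definition continuous_on_schwartz (V : (R -> C) -> Prop)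
  (T : (R -> C) -> (R -> C)) : Prop :=
  forall k n : nat, exists (K : R) (N : nat), forall (phi : R -> C) (B : R),
    V phi ->
    (forall i j : nat, (i <= N)%nat -> (j <= N)%nat -> seminorm_le i j phi B) ->
    seminorm_le k n (T phi) (K * B).

(* Closedness of the range is not listed: for closed subspaces [V] and [W] of the
   Schwartz space it follows from the other conditions by the open mapping theorem. *)
Definition fredholm (V W : (R -> C) -> Prop) (T : (R -> C) -> (R -> C)) : Prop :=
  (forall phi, V phi -> W (T phi)) /\
  linear_on V T /\
  continuous_on_schwartz V T /\
  (exists m, ker_dim V T m) /\
  (exists n, coker_dim V W T n).

Definition has_index (V W : (R -> C) -> Prop) (T : (R -> C) -> (R -> C))
  (d : Z) : Prop :=
  exists m n : nat, ker_dim V T m /\ coker_dim V W T n /\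
    d = (Z.of_nat m - Z.of_nat n)%Z.

(** * Rieffel projections *)

Definition U (phi : R -> C) : R -> C := fun x => phi (x + 1).
Definition Uinv (phi : R -> C) : R -> C := fun x => phi (x - 1).
Definition mult_by (h : R -> R) (phi : R -> C) : R -> C :=
  fun x => Cmult (RtoC (h x)) (phi x).

Definition smooth_periodic (theta : R) (h : R -> R) : Prop :=
  (forall (n : nat) (x : R), ex_derive_n h n x) /\
  (forall x, h (x + theta) = h x).

(* [a] is the representative in [(0, theta)] of [1] modulo [theta]. *)
Definition rieffel_data (theta eps : R) (f g : R -> R) : Prop :=
  let a := theta * frac_part (1 / theta) in
  0 < eps /\ eps < a /\ a + eps < theta /\
  smooth_periodic theta f /\ smooth_periodic theta g /\
  (forall x, 0 <= f x <= 1) /\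
  (forall x, eps <= x <= a -> f x = 1) /\
  (forall x, a + eps <= x <= theta -> f x = 0) /\
  (forall x, 0 < x < eps -> f x = 1 - f (x + 1)) /\
  (forall x, 0 <= x <= eps -> g x = sqrt (f x - f x ^ 2)) /\
  (forall x, eps <= x <= theta -> g x = 0).

(* [U^-1 g + f + g U] *)
Definition rieffel_op (f g : R -> R) (phi : R -> C) : R -> C :=
  fun x => Cplus (Cplus (Uinv (mult_by g phi) x) (mult_by f phi x))
                 (mult_by g (U phi) x).

(* [x + d/dx] *)
Definition annihilation (phi : R -> C) : R -> C :=
  fun x => Cplus (Cmult (RtoC x) (phi x)) (CDerive phi x).

Definition compressed (P : (R -> C) -> (R -> C)) (phi : R -> C) : R -> C :=
  P (annihilation (P phi)).

(* Main.v *)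
Require Import Defs.
From Stdlib Require Import Reals ZArith Lra Lia IndefiniteDescription FunctionalExtensionality.
From Coquelicot Require Import Coquelicot.
Open Scope R_scope.

(** Write [1 = N theta + a], [N] being the integer part of [1 / theta], and let [al = sqrt f],
    [be = sqrt (1 - f)]. The range of [P] consists of functions supported on the arcs
    from [n theta] to [n theta + a + eps] whose values near the left end of arc [n] and the
    right end of arc [n + N] are proportional to [al] and [be]. Gluing these ends turns
    the arcs into [N] lines, and [P(S(R))] into [N] copies of [S(R)]. Because
    [al^2 + be^2 = 1], the operator [x + d/dx] becomes [d/dy + X(y)] on each line. The
    difference [x - y] drops by [1] each time [y] advances by [a < 1], so [X] tends to minus
    infinity at plus infinity and to plus infinity at minus infinity: [d/dy + X] is
    injective on [S(R)], and its cokernel is spanned by the integrating factor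
    [exp (int X)]. The index is therefore [- N]. *)

(** The gluing is a unitary equivalence in disguise: [unchain] and [chain] act as an operator [T]
    and its adjoint, with [T T^* = P] and [T^* T = 1] on equivariant families, so questions about
    [D] on the range of [P] become questions about [T^* D T] on lines. Two difficulties shape the
    rest. The real line is cut into infinitely many pieces that are moved by unbounded translations,
    so Schwartz estimates must be carried through with constants uniform over the pieces; this is
    why they are stated for indexed families. And in the Schwartz space the cokernel cannot be read
    off from an adjoint: a complement of the range is found by solving [s' + X s = h - c w] with
    [w = exp (int X)]. The scalar [c] is the only freedom besides the constant of integration, and
    together they make the primitive of [w (h - c w)] vanish at both ends. Dividing by the tiny [w]
    must then preserve rapid decay, which is the analytic core; smoothness follows by bootstrapping,
    since [X] grows only linearly. *)

Definition cder (phi : R -> C) (x : R) (l : C) : Prop :=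
  is_derive (fun t => Re (phi t)) x (Re l) /\
  is_derive (fun t => Im (phi t)) x (Im l).

Lemma cder_is_derive (phi : R -> C) (x : R) (l : C) :
  cder phi x l -> is_derive (V := C_R_NormedModule) phi x l.
Proof.
intros [H1 H2].
apply (is_derive_ext (V := C_R_NormedModule)
  (fun t => plus (scal (Re (phi t)) (RtoC 1 : C_R_NormedModule))
                 (scal (Im (phi t)) (Ci : C_R_NormedModule)))).
{ intros t; destruct (phi t) as [u v].
  unfold Ci, RtoC; simpl.
  unfold plus, scal; simpl; unfold prod_plus, prod_scal; simpl.
  unfold plus, scal; simpl; unfold mult; simpl.
  f_equal; ring. }
replace l with
  (plus (scal (Re l) (RtoC 1 : C_R_NormedModule))
        (scal (Im l) (Ci : C_R_NormedModule))).
2:{ destruct l as [u v]; unfold Ci, RtoC; simpl.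
  unfold plus, scal; simpl; unfold prod_plus, prod_scal; simpl.
  unfold plus, scal; simpl; unfold mult; simpl.
  f_equal; ring. }
apply (is_derive_plus (V := C_R_NormedModule)).
- apply (is_derive_scal_l (V := C_R_NormedModule)); exact H1.
- apply (is_derive_scal_l (V := C_R_NormedModule)); exact H2.
Qed.

Lemma cder_CDerive (phi : R -> C) (x : R) (l : C) :
  cder phi x l -> CDerive phi x = l.
Proof.
intros [H1 H2]; destruct l as [u v]; unfold CDerive.
f_equal; apply is_derive_unique; assumption.
Qed.

Lemma ex_derive_cder (phi : R -> C) (x : R) :
  ex_derive (V := C_R_NormedModule) phi x -> cder phi x (CDerive phi x).
Proof.
intros [l Hl]; split.
- apply Derive_correct; exists (Re l).
  apply (filterdiff_comp' (V := C_R_NormedModule) phi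
           (fun z : C_R_NormedModule => (fst z : R_NormedModule)) x _
           (fun z : C_R_NormedModule => (fst z : R_NormedModule)) Hl).
  apply filterdiff_linear, (is_linear_fst (U := R_NormedModule) (V := R_NormedModule)).
- apply Derive_correct; exists (Im l).
  apply (filterdiff_comp' (V := C_R_NormedModule) phi
           (fun z : C_R_NormedModule => (snd z : R_NormedModule)) x _
           (fun z : C_R_NormedModule => (snd z : R_NormedModule)) Hl).
  apply filterdiff_linear, (is_linear_snd (U := R_NormedModule) (V := R_NormedModule)).
Qed.

Lemma cder_unique (phi : R -> C) (x : R) (l l' : C) :
  cder phi x l -> cder phi x l' -> l = l'.
Proof.
intros H H'; rewrite <- (cder_CDerive _ _ _ H); exact (cder_CDerive _ _ _ H').
Qed.

Lemma cder_ext_loc (phi psi : R -> C) (x : R) (l : C) :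
  locally x (fun t => phi t = psi t) -> cder phi x l -> cder psi x l.
Proof.
intros He [H1 H2]; split.
- apply (is_derive_ext_loc (fun t => Re (phi t))); [|exact H1].
  apply (filter_imp _ _ (fun t (H : phi t = psi t) => f_equal Re H) He).
- apply (is_derive_ext_loc (fun t => Im (phi t))); [|exact H2].
  apply (filter_imp _ _ (fun t (H : phi t = psi t) => f_equal Im H) He).
Qed.

Lemma cder_plus (phi psi : R -> C) (x : R) (l l' : C) :
  cder phi x l -> cder psi x l' ->
  cder (fun t => Cplus (phi t) (psi t)) x (Cplus l l').
Proof.
intros [H1 H2] [H3 H4]; split.
- exact (is_derive_plus _ _ _ _ _ H1 H3).
- exact (is_derive_plus _ _ _ _ _ H2 H4).
Qed.

Lemma cder_rmult (h : R -> R) (phi : R -> C) (x h' : R) (l : C) :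
  is_derive h x h' -> cder phi x l ->
  cder (fun t => Cmult (RtoC (h t)) (phi t)) x
    (Cplus (Cmult (RtoC h') (phi x)) (Cmult (RtoC (h x)) l)).
Proof.
intros H [H1 H2]; split.
- apply (is_derive_ext (fun t => h t * Re (phi t))).
  { intros t; unfold Cmult, RtoC, Re, Im; simpl; ring. }
  replace (Re _) with (h' * Re (phi x) + h x * Re l) by (unfold Cplus, Cmult, RtoC, Re, Im; simpl; ring).
  apply (is_derive_mult h (fun t => Re (phi t))); auto.
  intros; apply Rmult_comm.
- apply (is_derive_ext (fun t => h t * Im (phi t))).
  { intros t; unfold Cmult, RtoC, Re, Im; simpl; ring. }
  replace (Im _) with (h' * Im (phi x) + h x * Im l) by (unfold Cplus, Cmult, RtoC, Re, Im; simpl; ring).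
  apply (is_derive_mult h (fun t => Im (phi t))); auto.
  intros; apply Rmult_comm.
Qed.

Lemma is_derive_const_R (c x : R) : is_derive (fun _ : R => c) x 0.
Proof. exact (is_derive_const c x). Qed.

Lemma is_derive_shift (h : R -> R) (b x l : R) :
  is_derive h (x + b) l -> is_derive (fun t => h (t + b)) x l.
Proof.
intros H.
replace l with (scal 1 l) by (unfold scal; simpl; unfold mult; simpl; ring).
apply (is_derive_comp h (fun t => t + b) x l 1 H).
auto_derive; [trivial | ring].
Qed.

Lemma cder_shift (phi : R -> C) (b x : R) (l : C) :
  cder phi (x + b) l -> cder (fun t => phi (t + b)) x l.
Proof.
intros [H1 H2]; split.
- exact (is_derive_shift (fun t => Re (phi t)) b x _ H1).
- exact (is_derive_shift (fun t => Im (phi t)) b x _ H2).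
Qed.

Lemma cder_const (c : C) (x : R) : cder (fun _ => c) x (RtoC 0).
Proof. split; apply is_derive_const_R. Qed.

Lemma cder_cmult (c : C) (phi : R -> C) (x : R) (l : C) :
  cder phi x l -> cder (fun t => Cmult c (phi t)) x (Cmult c l).
Proof.
intros [H1 H2]; split; simpl.
- apply (is_derive_minus (fun t => Re c * Re (phi t)) (fun t => Im c * Im (phi t)));
    apply is_derive_scal; assumption.
- apply (is_derive_plus (fun t => Re c * Im (phi t)) (fun t => Im c * Re (phi t)));
    apply is_derive_scal; assumption.
Qed.

Lemma locally_Ioo (x u v : R) (Q : R -> Prop) :
  u < x < v -> (forall t, u < t < v -> Q t) -> locally x Q.
Proof.
intros Hx HQ.
assert (Hd : 0 < Rmin (x - u) (v - x)) by (apply Rmin_pos; lra).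
exists (mkposreal _ Hd); intros t Ht; apply HQ.
assert (H : Rabs (t - x) < Rmin (x - u) (v - x)) by exact Ht.
pose proof (Rmin_l (x - u) (v - x)); pose proof (Rmin_r (x - u) (v - x)).
apply Rabs_def2 in H; lra.
Qed.

(** * Uniform families of smooth functions *)

Definition wt (x : R) : R := 1 + Rabs x.

Lemma wt_ge1 (x : R) : 1 <= wt x.
Proof. unfold wt; pose proof (Rabs_pos x); lra. Qed.

Lemma wt_pow_pos (x : R) (k : nat) : 0 < wt x ^ k.
Proof. apply pow_lt; pose proof (wt_ge1 x); lra. Qed.

(* Rapid decay of [F i], together with its first [n] derivatives, uniformly in [i]:
   the bounds hold where [S N i] does (for some [N]) and are proportional to [nu i].
   With [nu = 1] and [S] independent of [N] this is uniform decay on the regions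
   [S i]; taking for [i] a Schwartz function with a bound for its seminorms of order
   at most [N], it is continuity of an operator. *)
Fixpoint decaying {I : Type} (S : nat -> I -> R -> Prop) (nu : I -> R)
  (n : nat) (F : I -> R -> C) : Prop :=
  (forall k, exists K N, forall i x, S N i x -> wt x ^ k * Cmod (F i x) <= K * nu i) /\
  match n with
  | O => True
  | Datatypes.S m => exists G, (forall i x, cder (F i) x (G i x)) /\ decaying S nu m G
  end.

(** One exponent [p] serves all derivatives. The bound is asked on [S O], the largest region when
    [S] is antitone, so it is available at whatever level a decay estimate uses. *)
Fixpoint tempered {I : Type} (S : nat -> I -> R -> Prop) (p : nat)
  (n : nat) (h : I -> R -> R) : Prop :=
  (exists B, 0 <= B /\ forall i x, S O i x -> Rabs (h i x) <= B * wt x ^ p) /\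
  match n with
  | O => True
  | Datatypes.S m =>
      exists h', (forall i x, is_derive (h i) x (h' i x)) /\ tempered S p m h'
  end.

(** A higher level is a stronger condition, so two estimates valid at different levels can be
    combined at their maximum. *)
Definition antitone {I : Type} (S : nat -> I -> R -> Prop) : Prop :=
  forall N M i x, (N <= M)%nat -> S M i x -> S N i x.

Section Families.
Context {I : Type} (S : nat -> I -> R -> Prop) (nu : I -> R) (HS : antitone S).

Lemma decaying_0 n F : decaying S nu n F -> decaying S nu 0 F.
Proof. destruct n; simpl; tauto. Qed.

Lemma tempered_0 p n h : tempered S p n h -> tempered S p 0 h.
Proof. destruct n; simpl; tauto. Qed.

Lemma decaying_S n F : decaying S nu (Datatypes.S n) F -> decaying S nu n F.
Proof.
revert F; induction n as [|n IH]; intros F [H0 [G [HG HG']]]; split; auto.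
exists G; split; auto.
Qed.

Lemma tempered_S p n h : tempered S p (Datatypes.S n) h -> tempered S p n h.
Proof.
revert h; induction n as [|n IH]; intros h [H0 [G [HG HG']]]; split; auto.
exists G; split; auto.
Qed.

Lemma decaying_plus n F G :
  decaying S nu n F -> decaying S nu n G ->
  decaying S nu n (fun i x => Cplus (F i x) (G i x)).
Proof.
revert F G; induction n as [|n IH]; intros F G [HF HF'] [HG HG'].
all: split.
1,3: intros k; destruct (HF k) as [K1 [N1 H1]], (HG k) as [K2 [N2 H2]];
  exists (K1 + K2), (Nat.max N1 N2); intros i x Hx;
  specialize (H1 i x (HS _ _ _ _ (Nat.le_max_l _ _) Hx));
  specialize (H2 i x (HS _ _ _ _ (Nat.le_max_r _ _) Hx));
  pose proof (Cmod_triangle (F i x) (G i x)); pose proof (wt_pow_pos x k);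
  apply Rle_trans with (wt x ^ k * (Cmod (F i x) + Cmod (G i x)));
  [apply Rmult_le_compat_l; lra | lra].
- exact Logic.I.
- destruct HF' as [F' [HF1 HF2]], HG' as [G' [HG1 HG2]].
  exists (fun i x => Cplus (F' i x) (G' i x)); split; [|auto].
  intros i x; apply cder_plus; auto.
Qed.

Lemma decaying_cmult n (c : C) F :
  decaying S nu n F -> decaying S nu n (fun i x => Cmult c (F i x)).
Proof.
revert F; induction n as [|n IH]; intros F [HF HF']; split.
1,3: intros k; destruct (HF k) as [K [N H]]; exists (Cmod c * K), N; intros i x Hx;
  specialize (H i x Hx); rewrite Cmod_mult;
  replace (wt x ^ k * (Cmod c * Cmod (F i x))) with (Cmod c * (wt x ^ k * Cmod (F i x))) by ring;
  rewrite Rmult_assoc; apply Rmult_le_compat_l; [apply Cmod_ge_0 | exact H].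
- exact Logic.I.
- destruct HF' as [G [H1 H2]]; exists (fun i x => Cmult c (G i x)); split; [|auto].
  intros i x; apply cder_cmult, H1.
Qed.

(** Decay of order [k + p] pays for growth of order [p]; the Leibniz rule brings derivatives back to
    the same estimate. *)
Lemma decaying_mult p n h F :
  tempered S p n h -> decaying S nu n F ->
  decaying S nu n (fun i x => Cmult (RtoC (h i x)) (F i x)).
Proof.
revert h F; induction n as [|n IH]; intros h F Hh HF.
all: split.
1,3: apply tempered_0 in Hh; apply decaying_0 in HF;
  destruct Hh as [[B [HB Hb]] _], HF as [HF _]; intros k;
  destruct (HF (k + p)%nat) as [K [N HK]]; exists (B * K), N; intros i x Hx;
  specialize (HK i x Hx); specialize (Hb i x (HS _ _ _ _ (Nat.le_0_l _) Hx));
  rewrite Cmod_mult, Cmod_R; rewrite pow_add in HK;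
  pose proof (wt_pow_pos x k); pose proof (Cmod_ge_0 (F i x));
  apply Rle_trans with (wt x ^ k * (B * wt x ^ p * Cmod (F i x)));
  [ apply Rmult_le_compat_l; [lra|]; apply Rmult_le_compat_r; assumption
  | apply Rle_trans with (B * (wt x ^ k * wt x ^ p * Cmod (F i x)));
    [ right; ring
    | rewrite (Rmult_assoc B K); apply Rmult_le_compat_l; assumption ] ].
- exact Logic.I.
- pose proof (tempered_S _ _ _ Hh) as Hh0; pose proof (decaying_S _ _ HF) as HF0.
  destruct Hh as [_ [h' [Hh1 Hh2]]], HF as [_ [F' [HF1 HF2]]].
  exists (fun i x => Cplus (Cmult (RtoC (h' i x)) (F i x)) (Cmult (RtoC (h i x)) (F' i x))).
  split.
  + intros i x; apply cder_rmult; auto.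
  + apply decaying_plus; apply IH; auto.
Qed.

Lemma tempered_mono p q n h : (p <= q)%nat -> tempered S p n h -> tempered S q n h.
Proof.
intros Hpq; revert h; induction n as [|n IH]; intros h [[B [HB H]] H']; split.
1,3: exists B; split; [exact HB|]; intros i x Hx;
  apply Rle_trans with (1 := H i x Hx); apply Rmult_le_compat_l; [exact HB|];
  apply Rle_pow; [apply wt_ge1 | exact Hpq].
- exact Logic.I.
- destruct H' as [h' [H1 H2]]; exists h'; auto.
Qed.

Lemma tempered_plus p n h k :
  tempered S p n h -> tempered S p n k -> tempered S p n (fun i x => h i x + k i x).
Proof.
revert h k; induction n as [|n IH]; intros h k [[B [HB H]] H'] [[B' [HB' K]] K']; split.
1,3: exists (B + B'); split; [lra|]; intros i x Hx;
  apply Rle_trans with (1 := Rabs_triang _ _); specialize (H i x Hx);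
  specialize (K i x Hx); lra.
- exact Logic.I.
- destruct H' as [h' [H1 H2]], K' as [k' [K1 K2]].
  exists (fun i x => h' i x + k' i x); split; [|auto].
  intros i x; apply (is_derive_plus (h i) (k i)); auto.
Qed.

(** The first factor is bounded, so the exponent does not increase and both Leibniz terms stay in
    the class. *)
Lemma tempered_mult p n h k :
  tempered S 0 n h -> tempered S p n k -> tempered S p n (fun i x => h i x * k i x).
Proof.
revert h k; induction n as [|n IH]; intros h k Hh Hk; split.
1,3: apply tempered_0 in Hh; apply tempered_0 in Hk;
  destruct Hh as [[B [HB H]] _], Hk as [[B' [HB' K]] _];
  exists (B * B'); split; [apply Rmult_le_pos; lra|]; intros i x Hx;
  rewrite Rabs_mult; specialize (H i x Hx); specialize (K i x Hx);
  simpl in H; rewrite Rmult_1_r in H; rewrite Rmult_assoc;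
  apply Rmult_le_compat; auto; apply Rabs_pos.
- exact Logic.I.
- pose proof (tempered_S _ _ _ Hh) as Hh0; pose proof (tempered_S _ _ _ Hk) as Hk0.
  destruct Hh as [_ [h' [H1 H2]]], Hk as [_ [k' [K1 K2]]].
  exists (fun i x => h' i x * k i x + h i x * k' i x); split.
  + intros i x; apply (is_derive_mult (h i) (k i)); auto; intros; apply Rmult_comm.
  + apply tempered_plus; apply IH; auto.
Qed.

Lemma tempered_const p n (c : I -> R) (B : R) :
  (forall i, Rabs (c i) <= B) -> tempered S p n (fun i _ => c i).
Proof.
intros Hc; apply (tempered_mono 0); [apply Nat.le_0_l|].
revert c B Hc; induction n as [|n IH]; intros c B Hc; split.
1,3: exists (Rabs B); split; [apply Rabs_pos|]; intros i x _; simpl;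
  pose proof (Hc i); pose proof (Rle_abs B); lra.
- exact Logic.I.
- exists (fun _ _ => 0); split; [intros; apply is_derive_const_R|].
  apply (IH (fun _ => 0) 0); intros; rewrite Rabs_R0; lra.
Qed.

Lemma tempered_id n : tempered S 1 n (fun _ x => x).
Proof.
destruct n; split.
1,3: exists 1; split; [lra|]; intros i x _; unfold wt; simpl; lra.
- exact Logic.I.
- exists (fun _ _ => 1); split.
  + intros _ x; exact (is_derive_id x).
  + apply (tempered_const 1 n (fun _ => 1) 1); intros; rewrite Rabs_R1; lra.
Qed.

End Families.

(** Translations by amounts [b j] that depend on the index keep the bounds uniform if a single
    [kappa] compares the weights before and after. For unbounded [b] this is possible only because
    [S'] localizes [x]. *)
Lemma decaying_reindex {I J : Type} (S : nat -> I -> R -> Prop)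
  (S' : nat -> J -> R -> Prop) (nu : I -> R) (n : nat) (F : I -> R -> C)
  (u : J -> I) (b : J -> R) (kappa : R) :
  0 <= kappa ->
  (forall N j x, S' N j x -> S N (u j) (x + b j) /\ wt x <= kappa * wt (x + b j)) ->
  decaying S nu n F -> decaying S' (fun j => nu (u j)) n (fun j x => F (u j) (x + b j)).
Proof.
intros Hk HS'; revert F; induction n as [|n IH]; intros F [HF HF']; split.
1,3: intros k; destruct (HF k) as [K [N H]]; exists (kappa ^ k * K), N; intros j x Hx;
  destruct (HS' _ _ _ Hx) as [H1 H2]; specialize (H (u j) _ H1);
  pose proof (wt_ge1 x); pose proof (Cmod_ge_0 (F (u j) (x + b j)));
  apply Rle_trans with ((kappa * wt (x + b j)) ^ k * Cmod (F (u j) (x + b j)));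
  [ apply Rmult_le_compat_r; [lra|]; apply pow_incr; lra
  | rewrite Rpow_mult_distr, !Rmult_assoc; apply Rmult_le_compat_l;
    [apply pow_le; lra | exact H] ].
- exact Logic.I.
- destruct HF' as [G [H1 H2]]; exists (fun j x => G (u j) (x + b j)); split; [|auto].
  intros j x; apply cder_shift; auto.
Qed.

Lemma tempered_reindex {I J : Type} (S : nat -> J -> R -> Prop)
  (n : nat) (h : I -> R -> R) (u : J -> I) (b : J -> R) :
  tempered (fun _ _ _ => True) 0 n h -> tempered S 0 n (fun j x => h (u j) (x + b j)).
Proof.
revert h; induction n as [|n IH]; intros h [[B [HB H]] H']; split.
1,3: exists B; split; [exact HB|]; intros j x _; exact (H _ _ Logic.I).
- exact Logic.I.
- destruct H' as [h' [H1 H2]]; exists (fun j x => h' (u j) (x + b j)); split; [|auto].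
  intros j x; apply is_derive_shift; auto.
Qed.

Lemma decaying_CDerive {I : Type} (S : nat -> I -> R -> Prop) (nu : I -> R) n F :
  decaying S nu (Datatypes.S n) F ->
  (forall i x, cder (F i) x (CDerive (F i) x)) /\
  decaying S nu n (fun i => CDerive (F i)).
Proof.
intros [_ [G [HG HG']]].
assert (E : (fun i => CDerive (F i)) = G).
{ extensionality i; extensionality x; exact (cder_CDerive _ _ _ (HG i x)). }
rewrite E; split; [|exact HG'].
intros i x; rewrite (cder_CDerive _ _ _ (HG i x)); apply HG.
Qed.

Lemma CDerive_n_S n phi : CDerive_n (S n) phi = CDerive_n n (CDerive phi).
Proof. unfold CDerive_n; rewrite Nat.iter_succ_r; reflexivity. Qed.

Lemma decaying_CDerive_n {I : Type} (S : nat -> I -> R -> Prop) (nu : I -> R) j n F :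
  decaying S nu (j + n) F -> decaying S nu n (fun i => CDerive_n j (F i)).
Proof.
revert F; induction j as [|j IH]; intros F HF; [exact HF|].
apply decaying_CDerive in HF; destruct HF as [_ HF]; apply IH in HF.
replace (fun i => CDerive_n (Datatypes.S j) (F i)) with
  (fun i => CDerive_n j (CDerive (F i))); [exact HF|].
extensionality i; rewrite CDerive_n_S; reflexivity.
Qed.

Lemma wt_pow_le (x : R) (k : nat) : wt x ^ k <= 2 ^ k * (1 + Rabs x ^ k).
Proof.
unfold wt; pose proof (Rabs_pos x) as Hx; set (y := Rabs x) in *.
pose proof (pow_le 2 k ltac:(lra)); pose proof (pow_le y k Hx).
destruct (Rle_dec y 1) as [H1|H1].
- apply Rle_trans with (2 ^ k * 1); [|apply Rmult_le_compat_l; lra].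
  rewrite Rmult_1_r; apply pow_incr; lra.
- apply Rle_trans with (2 ^ k * y ^ k); [|apply Rmult_le_compat_l; lra].
  rewrite <- Rpow_mult_distr; apply pow_incr; lra.
Qed.

Lemma decaying_seminorms {I : Type} (S : nat -> I -> R -> Prop) (nu : I -> R) F :
  antitone S ->
  (forall i n x, ex_derive (V := C_R_NormedModule) (CDerive_n n (F i)) x) ->
  (forall k n, exists K N, forall i x, S N i x ->
     Rabs x ^ k * Cmod (CDerive_n n (F i) x) <= K * nu i) ->
  forall n, decaying S nu n F.
Proof.
intros HS Hd Hs.
(* The claim is generalized over the number [j] of derivatives already taken, since the induction on
   the remaining ones passes from [j] to [j + 1]. *)
enough (H : forall n j, decaying S nu n (fun i => CDerive_n j (F i)))
  by (intros n; exact (H n 0%nat)).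
induction n as [|n IH]; intros j; split.
1,3: intros k; destruct (Hs 0%nat j) as [K1 [N1 H1]], (Hs k j) as [K2 [N2 H2]];
  exists (2 ^ k * (K1 + K2)), (Nat.max N1 N2); intros i x Hx;
  specialize (H1 i x (HS _ _ _ _ (Nat.le_max_l _ _) Hx));
  specialize (H2 i x (HS _ _ _ _ (Nat.le_max_r _ _) Hx));
  pose proof (wt_pow_le x k); pose proof (Cmod_ge_0 (CDerive_n j (F i) x));
  simpl in H1;
  apply Rle_trans with (2 ^ k * (1 + Rabs x ^ k) * Cmod (CDerive_n j (F i) x));
  [ apply Rmult_le_compat_r; assumption
  | rewrite !Rmult_assoc; apply Rmult_le_compat_l; [apply pow_le|]; lra ].
- exact Logic.I.
- exists (fun i => CDerive_n (Datatypes.S j) (F i)); split; [|apply IH].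
  intros i x; apply ex_derive_cder, Hd.
Qed.

(** * Schwartz functions as one-member decaying families *)

Definition everywhere {I : Type} : nat -> I -> R -> Prop := fun _ _ _ => True.

Definition rapid (n : nat) (phi : R -> C) : Prop :=
  decaying (I := unit) everywhere (fun _ => 1) n (fun _ => phi).

Lemma antitone_everywhere {I : Type} : antitone (@everywhere I).
Proof. intros N M i x _ _; exact Logic.I. Qed.

Lemma rapid_cder (n : nat) (phi : R -> C) :
  rapid (S n) phi -> forall x, cder phi x (CDerive phi x).
Proof.
intros H; exact (proj1 (decaying_CDerive everywhere (fun _ => 1) n (fun _ : unit => phi) H) tt).
Qed.

Lemma schwartz_rapid (phi : R -> C) : schwartz phi <-> forall n, rapid n phi.
Proof.
split.
- intros [Hd Hs]; apply decaying_seminorms; [apply antitone_everywhere| |].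
  + intros _; exact Hd.
  + intros k n; destruct (Hs k n) as [B HB]; exists B, 0%nat; intros _ x _.
    rewrite Rmult_1_r; apply HB.
- intros H; split.
  + intros n x; specialize (H (n + 1)%nat).
    apply decaying_CDerive_n, decaying_CDerive in H; destruct H as [H _].
    eexists; apply cder_is_derive, (H tt x).
  + intros k n; specialize (H (n + 0)%nat).
    apply decaying_CDerive_n in H; destruct H as [H _]; destruct (H k) as [K [N HK]].
    exists K; intros x; specialize (HK tt x Logic.I); rewrite Rmult_1_r in HK.
    apply Rle_trans with (2 := HK).
    apply Rmult_le_compat_r; [apply Cmod_ge_0|].
    apply pow_incr; unfold wt; pose proof (Rabs_pos x); lra.
Qed.

(** * Gluing along a lattice *)

Definition fl (p x : R) : Z := Int_part (x / p).

Definition glue {V : Type} (p : R) (F : Z -> R -> V) (x : R) : V := F (fl p x) x.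

Definition cell (p : R) (N : nat) (m : Z) (x : R) : Prop :=
  IZR m * p <= x < IZR m * p + p.

(** Cells contain their left end, so at the junction [IZR m * p] piece [m] is already in force and
    has to match its neighbour only on the left. That makes a single piece valid on a full
    neighbourhood of the junction. *)
Definition agree {V : Type} (p : R) (F : Z -> R -> V) : Prop :=
  exists d, 0 < d /\ forall m x, IZR m * p - d < x < IZR m * p -> F m x = F (m - 1)%Z x.

Lemma antitone_cell (p : R) : antitone (cell p).
Proof. intros N M i x _ H; exact H. Qed.

Lemma fl_cell (p x : R) : 0 < p -> cell p 0 (fl p x) x.
Proof.
intros Hp; unfold cell, fl; destruct (base_Int_part (x / p)) as [H1 H2].
set (k := IZR (Int_part (x / p))) in *; replace x with (x / p * p) by (field; lra).
split; [apply Rmult_le_compat_r; lra|].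
replace (k * p + p) with ((k + 1) * p) by ring; apply Rmult_lt_compat_r; lra.
Qed.

Lemma fl_unique (p x : R) (m : Z) : 0 < p -> cell p 0 m x -> fl p x = m.
Proof.
intros Hp [H1 H2]; destruct (fl_cell p x Hp) as [H3 H4]; set (k := fl p x) in *.
assert (k < m + 1)%Z.
{ apply lt_IZR; rewrite plus_IZR; apply Rmult_lt_reg_r with p; lra. }
assert (m < k + 1)%Z.
{ apply lt_IZR; rewrite plus_IZR; apply Rmult_lt_reg_r with p; lra. }
lia.
Qed.

Lemma glue_cell {V : Type} (p : R) (F : Z -> R -> V) (m : Z) (x : R) :
  0 < p -> IZR m * p <= x < IZR m * p + p -> glue p F x = F m x.
Proof. intros Hp H; unfold glue; rewrite (fl_unique p x m Hp H); reflexivity. Qed.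

Lemma glue_locally {V : Type} (p : R) (F : Z -> R -> V) (x : R) :
  0 < p -> agree p F -> locally x (fun t => F (fl p x) t = glue p F t).
Proof.
intros Hp [d [Hd HF]]; destruct (fl_cell p x Hp) as [H1 H2]; set (m := fl p x) in *.
pose proof (Rmin_l d p); pose proof (Rmin_r d p).
assert (0 < Rmin d p) by (apply Rmin_pos; lra).
(* The minimum with [p] keeps [t] inside the preceding cell when it crosses the junction. *)
apply (locally_Ioo x (IZR m * p - Rmin d p) (IZR m * p + p)); [lra|].
intros t Ht; destruct (Rlt_dec t (IZR m * p)) as [Hl|Hl].
- rewrite (glue_cell p F (m - 1)%Z); [apply HF; lra | lra|].
  rewrite minus_IZR; lra.
- symmetry; apply glue_cell; lra.
Qed.

Lemma glue_cder (p : R) (F G : Z -> R -> C) (x : R) :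
  0 < p -> agree p F -> (forall m t, cder (F m) t (G m t)) ->
  cder (glue p F) x (glue p G x).
Proof.
intros Hp Ha HF; apply (cder_ext_loc (F (fl p x))); [|apply HF].
apply glue_locally; assumption.
Qed.

Lemma glue_is_derive (p : R) (F G : Z -> R -> R) (x : R) :
  0 < p -> agree p F -> (forall m t, is_derive (F m) t (G m t)) ->
  is_derive (glue p F) x (glue p G x).
Proof.
intros Hp Ha HF; apply (is_derive_ext_loc (F (fl p x))); [|apply HF].
apply glue_locally; assumption.
Qed.

(** Functions that coincide on an open interval have the same derivative there, so agreement is
    checked once and inherited at every order. *)
Lemma agree_cder (p : R) (F G : Z -> R -> C) :
  agree p F -> (forall m t, cder (F m) t (G m t)) -> agree p G.
Proof.
intros [d [Hd HF]] HG; exists d; split; [exact Hd|].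
intros m x Hx; apply (cder_unique (F m) x); [apply HG|].
apply (cder_ext_loc (F (m - 1)%Z)); [|apply HG].
apply (locally_Ioo _ _ _ _ Hx); intros t Ht; symmetry; apply HF, Ht.
Qed.

Lemma agree_is_derive (p : R) (F G : Z -> R -> R) :
  agree p F -> (forall m t, is_derive (F m) t (G m t)) -> agree p G.
Proof.
intros [d [Hd HF]] HG; exists d; split; [exact Hd|].
intros m x Hx; rewrite <- (is_derive_unique _ _ _ (HG m x)).
apply is_derive_unique, (is_derive_ext_loc (F (m - 1)%Z)); [|apply HG].
apply (locally_Ioo _ _ _ _ Hx); intros t Ht; symmetry; apply HF, Ht.
Qed.

Lemma glue_rapid (p : R) (n : nat) (F : Z -> R -> C) :
  0 < p -> agree p F -> decaying (cell p) (fun _ => 1) n F -> rapid n (glue p F).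
Proof.
intros Hp; revert F; induction n as [|n IH]; intros F Ha [HF HF']; split.
1,3: intros k; destruct (HF k) as [K [N H]]; exists K, N; intros _ x _;
  apply H, fl_cell, Hp.
- exact Logic.I.
- destruct HF' as [G [H1 H2]]; exists (fun _ => glue p G); split.
  + intros _ x; apply glue_cder; auto.
  + apply IH; [apply (agree_cder p F) |]; auto.
Qed.

Lemma glue_tempered (p : R) (q n : nat) (F : Z -> R -> R) :
  0 < p -> agree p F -> tempered (cell p) q n F ->
  tempered (I := unit) everywhere q n (fun _ => glue p F).
Proof.
intros Hp; revert F; induction n as [|n IH]; intros F Ha [[B [HB HF]] HF']; split.
1,3: exists B; split; [exact HB|]; intros _ x _; apply HF, fl_cell, Hp.
- exact Logic.I.
- destruct HF' as [G [H1 H2]]; exists (fun _ => glue p G); split.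
  + intros _ x; apply glue_is_derive; auto.
  + apply IH; [apply (agree_is_derive p F) |]; auto.
Qed.

(** * The equation s' + X s = h on the line *)

Lemma nonincreasing_right (G dG : R -> R) (a x y : R) :
  (forall t, is_derive G t (dG t)) -> (forall t, a <= t -> dG t <= 0) ->
  a <= x <= y -> G y <= G x.
Proof.
intros HG Hd Hxy.
destruct (MVT_gen G x y dG) as [c [Hc E]].
- intros t _; apply HG.
- intros t _; apply continuity_pt_filterlim, (ex_derive_continuous G).
  eexists; apply HG.
- rewrite Rmin_left, Rmax_right in Hc by lra.
  assert (dG c * (y - x) <= 0); [|lra].
  pose proof (Hd c ltac:(lra)).
  apply Ropp_le_cancel; rewrite Ropp_0, <- Ropp_mult_distr_l_reverse.
  apply Rmult_le_pos; lra.
Qed.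

Lemma continuous_bounded (h : R -> R) (a b : R) :
  (forall x, continuous h x) -> exists B, 0 <= B /\ forall x, a <= x <= b -> Rabs (h x) <= B.
Proof.
intros Hh; destruct (Rle_dec a b) as [Hab|Hab].
2:{ exists 0; split; [lra|]; intros x Hx; lra. }
destruct (continuity_ab_maj (fun x => Rabs (h x)) a b Hab) as [M [HM _]].
{ intros c _; apply continuity_pt_filterlim.
  apply (continuous_comp h Rabs); [apply Hh | apply continuous_Rabs]. }
exists (Rabs (h M)); split; [apply Rabs_pos | exact HM].
Qed.

Definition rapid_R (h : R -> R) : Prop :=
  forall k, exists B, forall x, wt x ^ k * Rabs (h x) <= B.

(** Only the right end is described; the left end is obtained by applying the same notion to the
    reflected data [- X (- y)] and [w (- y)]. The bound [-1] makes [w' <= - w] far out. *)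
Definition solves_right (X w : R -> R) (Y0 : R) : Prop :=
  0 <= Y0 /\ (forall y, 0 < w y) /\ (forall y, is_derive w y (X y * w y)) /\
  (forall y, Y0 <= y -> X y <= -1).

Lemma wt_nonneg_eq (x : R) : 0 <= x -> wt x = 1 + x.
Proof. intros H; unfold wt; rewrite Rabs_pos_eq; auto. Qed.

(** The derivative of [(1 + y)^k w] is [(1 + y)^(k-1) w (k + (1 + y) X)], which is nonpositive once
    [y] exceeds both [Y0] and [k]. Continuity takes care of the compact interval before that. *)
Lemma solves_right_decay X w Y0 (k : nat) :
  solves_right X w Y0 -> exists B, 0 <= B /\ forall y, 0 <= y -> wt y ^ k * w y <= B.
Proof.
intros [HY [Hw [Hw' HX]]].
pose proof (pos_INR k) as Hk0; set (M := Rmax Y0 (INR k)).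
assert (HM : Y0 <= M /\ INR k <= M) by (split; [apply Rmax_l | apply Rmax_r]).
destruct (continuous_bounded (fun y => (1 + y) ^ k * w y) 0 M) as [B [HB HB']].
{ intros x; apply (ex_derive_continuous (fun y => (1 + y) ^ k * w y)).
  auto_derive; eexists; apply Hw'. }
exists B; split; [exact HB|]; intros y Hy; rewrite wt_nonneg_eq by exact Hy.
assert (Hle : forall z, 0 <= z <= M -> (1 + z) ^ k * w z <= B).
{ intros z Hz; apply Rle_trans with (2 := HB' z Hz), Rle_abs. }
destruct (Rle_dec y M) as [Hy'|Hy']; [apply Hle; lra|].
apply Rle_trans with ((1 + M) ^ k * w M); [|apply Hle; lra].
apply (nonincreasing_right (fun z => (1 + z) ^ k * w z)
  (fun z => INR k * (1 + z) ^ pred k * w z + (1 + z) ^ k * (X z * w z)) M); [| |lra].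
- intros t; auto_derive; [eexists; apply Hw'|].
  change (fun x : R_AbsRing => w x) with w; change (fun x : R => w x) with w.
  rewrite (is_derive_unique w _ _ (Hw' t)); ring.
- intros t Ht; pose proof (HX t ltac:(lra)); pose proof (Hw t).
  destruct k as [|k].
  + simpl; assert (0 <= - X t * w t) by (apply Rmult_le_pos; lra); lra.
  + change (pred (Datatypes.S k)) with k; set (K := INR (Datatypes.S k)) in *.
    replace (_ + _) with (- ((1 + t) ^ k * w t * (- (1 + t) * X t - K))) by (simpl; ring).
    enough (0 <= (1 + t) ^ k * w t * (- (1 + t) * X t - K)) by lra.
    apply Rmult_le_pos; [apply Rmult_le_pos; [apply pow_le|]; lra|].
    assert (0 <= (1 + t) * (- X t - 1)) by (apply Rmult_le_pos; lra); lra.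
Qed.

Lemma solves_right_lim X w Y0 :
  solves_right X w Y0 -> forall B e, 0 < e -> exists M, Y0 <= M /\ forall t, M <= t -> B * w t < e.
Proof.
intros HS B e He; destruct (solves_right_decay X w Y0 1 HS) as [K [HK H]].
destruct HS as [HY [Hw _]].
(* From [(1 + t) w t <= K] it follows that [Rabs B * w t] is below [e] as soon as [1 + t] exceeds
   [Rabs B * K / e]. *)
exists (Y0 + Rabs B * K / e).
assert (0 <= Rabs B * K / e).
{ apply Rmult_le_pos; [apply Rmult_le_pos; [apply Rabs_pos | exact HK]|].
  left; apply Rinv_0_lt_compat, He. }
split; [lra|]; intros t Ht.
specialize (H t ltac:(lra)); rewrite wt_nonneg_eq in H by lra; specialize (Hw t).
apply Rle_lt_trans with (Rabs B * w t); [apply Rmult_le_compat_r; [lra | apply Rle_abs]|].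
apply Rmult_lt_reg_r with (1 + t); [lra|].
apply Rle_lt_trans with (Rabs B * K).
- rewrite Rmult_assoc; apply Rmult_le_compat_l; [apply Rabs_pos | lra].
- replace (Rabs B * K) with (e * (Rabs B * K / e)) by (field; lra).
  apply Rmult_lt_compat_l; lra.
Qed.

(* Since [w' <= - w], the functions [H + C w] and [H - C w] are monotone as soon as
   [H' = w k] and [|k| <= C]. *)
Lemma tail_bound X w Y0 (H k : R -> R) (C y t : R) :
  solves_right X w Y0 -> (forall x, is_derive H x (w x * k x)) ->
  Y0 <= y <= t -> (forall x, y <= x -> Rabs (k x) <= C) ->
  Rabs (H t - H y) <= C * (w y - w t).
Proof.
intros [HY [Hw [Hw' HX]]] HH Hyt HC.
assert (Hs : forall z, y <= z -> 0 <= w z * (- C * X z - Rabs (k z))).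
{ intros z Hz; specialize (HC z Hz); specialize (HX z ltac:(lra)).
  apply Rmult_le_pos; [left; apply Hw|].
  assert (0 <= C * (- X z - 1)); [|lra].
  apply Rmult_le_pos; [|lra]; pose proof (Rabs_pos (k z)); lra. }
assert (H1 : H t + C * w t <= H y + C * w y).
{ apply (nonincreasing_right (fun z => H z + C * w z)
    (fun z => w z * k z + C * (X z * w z)) y); [| |lra].
  - intros z; apply (is_derive_plus H (fun z => C * w z)); [apply HH|].
    apply is_derive_scal, Hw'.
  - intros z Hz; specialize (Hs z Hz).
    assert (w z * k z <= w z * Rabs (k z)); [|lra].
    apply Rmult_le_compat_l; [left; apply Hw | apply Rle_abs]. }
assert (H2 : - H t + C * w t <= - H y + C * w y).
{ apply (nonincreasing_right (fun z => - H z + C * w z)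
    (fun z => - (w z * k z) + C * (X z * w z)) y); [| |lra].
  - intros z; apply (is_derive_plus (fun z => - H z) (fun z => C * w z)).
    + apply (is_derive_opp H), HH.
    + apply is_derive_scal, Hw'.
  - intros z Hz; specialize (Hs z Hz).
    assert (w z * - k z <= w z * Rabs (k z)); [|lra].
    apply Rmult_le_compat_l; [left; apply Hw | rewrite <- Rabs_Ropp; apply Rle_abs]. }
apply Rabs_le; lra.
Qed.

(** By the tail estimate [H - C0 w] is nondecreasing and bounded beyond [Y0], and [w] tends to zero,
    so its supremum is the limit of [H]. The error bound lets [C] depend on [y]: only the size of
    [k] beyond [y] enters, and this is what later carries the decay of [k] over to the solution. *)
Lemma tail_limit X w Y0 (H k : R -> R) (C0 : R) :
  solves_right X w Y0 -> (forall x, is_derive H x (w x * k x)) ->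
  (forall x, Y0 <= x -> Rabs (k x) <= C0) ->
  exists L : R, is_lim H p_infty L /\
    forall y C, Y0 <= y -> (forall x, y <= x -> Rabs (k x) <= C) -> Rabs (H y - L) <= C * w y.
Proof.
intros HS HH HC0.
assert (Hw : forall y, 0 < w y) by apply HS.
assert (HT := fun C y t => tail_bound X w Y0 H k C y t HS HH).
assert (HC0p : 0 <= C0) by (pose proof (HC0 Y0 (Rle_refl _)); pose proof (Rabs_pos (k Y0)); lra).
destruct (completeness (fun v => exists t, Y0 <= t /\ v = H t - C0 * w t)) as [L [HL1 HL2]].
{ exists (H Y0 + C0 * w Y0); intros v [t [Ht ->]].
  assert (0 <= C0 * w t) by (apply Rmult_le_pos; [|left]; auto).
  pose proof (HT C0 Y0 t ltac:(lra) HC0) as HT'; apply Rabs_le_between in HT'; lra. }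
{ exists (H Y0 - C0 * w Y0), Y0; split; [lra | reflexivity]. }
assert (Hb : forall y C, Y0 <= y -> (forall x, y <= x -> Rabs (k x) <= C) ->
  Rabs (H y - L) <= C * w y).
{ intros y C Hy HC.
  assert (HCp : 0 <= C) by (pose proof (HC y (Rle_refl _)); pose proof (Rabs_pos (k y)); lra).
  assert (Hcw : 0 <= C * w y) by (apply Rmult_le_pos; [|left]; auto).
  apply Rabs_le; split.
  - assert (L <= H y + C * w y); [|lra].
    apply HL2; intros v [t [Ht ->]].
    assert (0 <= C0 * w t) by (apply Rmult_le_pos; [|left]; auto).
    destruct (Rle_dec y t) as [Hyt|Hyt].
    + pose proof (HT C y t ltac:(lra) HC) as HT'; apply Rabs_le_between in HT'.
      assert (0 <= C * w t) by (apply Rmult_le_pos; [|left]; auto); lra.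
    + pose proof (HT C0 t y ltac:(lra) (fun x Hx => HC0 x ltac:(lra))) as HT'.
      apply Rabs_le_between in HT'.
      assert (0 <= C0 * w y) by (apply Rmult_le_pos; [|left]; auto); lra.
  - assert (H y - C * w y <= L); [|lra].
    apply le_epsilon; intros e He.
    destruct (solves_right_lim X w Y0 HS C0 e He) as [M [HM HM']].
    set (t := Rmax M y).
    assert (Ht : M <= t /\ y <= t) by (split; [apply Rmax_l | apply Rmax_r]).
    specialize (HM' t ltac:(lra)).
    assert (H t - C0 * w t <= L) by (apply HL1; exists t; split; [lra | reflexivity]).
    pose proof (HT C y t ltac:(lra) HC) as HT'; apply Rabs_le_between in HT'.
    assert (0 <= C * w t) by (apply Rmult_le_pos; [|left]; auto); lra. }
exists L; split; [|exact Hb].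
apply is_lim_spec; intros e.
destruct (solves_right_lim X w Y0 HS C0 e (cond_pos e)) as [M [HM HM']].
exists M; intros t Ht; apply Rle_lt_trans with (C0 * w t); [|apply HM'; lra].
apply Hb; [lra | intros; apply HC0; lra].
Qed.

Lemma is_derive_reflect (h : R -> R) (x l : R) :
  is_derive h (- x) l -> is_derive (fun t => h (- t)) x (- l).
Proof.
intros H; replace (- l) with (scal (-1) l) by (unfold scal; simpl; unfold mult; simpl; ring).
apply (is_derive_comp h Ropp x l (-1) H).
auto_derive; [trivial | ring].
Qed.

Lemma is_derive_integral (h : R -> R) (x : R) :
  (forall y, continuous h y) -> is_derive (fun y => RInt h 0 y) x (h x).
Proof.
intros Hh; apply (is_derive_RInt h (RInt h 0) 0 x); [|apply Hh].
apply filter_forall; intros z; apply (RInt_correct (V := R_CompleteNormedModule)).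
apply (ex_RInt_continuous (V := R_CompleteNormedModule)); auto.
Qed.

(* [w] is an integrating factor: [(s w)' = w (s' + X s)]. *)
Definition integrating_factor (X w : R -> R) (Y0 : R) : Prop :=
  solves_right X w Y0 /\ solves_right (fun y => - X (- y)) (fun y => w (- y)) Y0.

Definition exp_primitive (X : R -> R) (y : R) : R := exp (RInt X 0 y).

Lemma exp_primitive_integrating (X : R -> R) (Y0 : R) :
  0 <= Y0 -> (forall y, continuous X y) ->
  (forall y, Y0 <= y -> X y <= -1) -> (forall y, y <= - Y0 -> 1 <= X y) ->
  integrating_factor X (exp_primitive X) Y0.
Proof.
intros HY HX Hr Hl.
assert (Hd : forall y, is_derive (exp_primitive X) y (X y * exp_primitive X y)).
{ intros y; apply (is_derive_comp exp (fun y => RInt X 0 y)); [apply is_derive_exp|].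
  apply (is_derive_integral X y HX). }
split; (split; [exact HY|]); (split; [intros; apply exp_pos|]); split; auto.
- intros y; rewrite Ropp_mult_distr_l_reverse; apply is_derive_reflect, Hd.
- intros y Hy; specialize (Hl (- y) ltac:(lra)); lra.
Qed.

Lemma integrating_factor_rapid X w Y0 : integrating_factor X w Y0 -> rapid_R w.
Proof.
intros [Hr Hl] k.
destruct (solves_right_decay _ _ _ k Hr) as [B1 [HB1 H1]].
destruct (solves_right_decay _ _ _ k Hl) as [B2 [HB2 H2]].
exists (B1 + B2); intros x; rewrite Rabs_pos_eq by (left; apply Hr).
destruct (Rle_dec 0 x) as [Hx|Hx]; [specialize (H1 x Hx); lra|].
specialize (H2 (- x) ltac:(lra)); rewrite Ropp_involutive in H2.
unfold wt in *; rewrite Rabs_Ropp in H2; lra.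
Qed.

Lemma rapid_R_bounded h : rapid_R h -> exists B, forall x, Rabs (h x) <= B.
Proof. intros H; destruct (H O) as [B HB]; exists B; intros x; specialize (HB x); simpl in HB; lra. Qed.

Lemma rapid_R_tail (h : R -> R) (k : nat) :
  rapid_R h -> exists B, forall y x, 0 <= y <= x -> Rabs (h x) <= B / wt y ^ k.
Proof.
intros H; destruct (H k) as [B HB]; exists B; intros y x Hyx; specialize (HB x).
pose proof (wt_pow_pos y k) as Hy.
apply Rmult_le_reg_l with (wt y ^ k); [exact Hy|].
replace (wt y ^ k * (B / wt y ^ k)) with B by (field; lra).
apply Rle_trans with (2 := HB), Rmult_le_compat_r; [apply Rabs_pos|].
apply pow_incr; rewrite !wt_nonneg_eq by lra; lra.
Qed.

(** Beyond [y] the function [k] is at most [B / wt y ^ p], so [H y - L] is at most that number times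
    [w y]. The factor [w y] cancels the division by [w], and the decay of [k] survives intact. *)
Lemma ode_rapid_right X w Y0 (H k : R -> R) (L : R) (p : nat) :
  solves_right X w Y0 -> (forall x, is_derive H x (w x * k x)) -> rapid_R k ->
  is_lim H p_infty L ->
  exists B, forall y, Y0 <= y -> wt y ^ p * Rabs ((H y - L) / w y) <= B.
Proof.
intros HS HH Hk HL.
destruct (rapid_R_bounded k Hk) as [C0 HC0].
destruct (tail_limit X w Y0 H k C0 HS HH (fun x _ => HC0 x)) as [L' [HL' Hb]].
assert (E : L = L').
{ apply is_lim_unique in HL; apply is_lim_unique in HL'.
  rewrite HL in HL'; injection HL'; auto. }
destruct (rapid_R_tail k p Hk) as [B HB]; exists B; intros y Hy.
destruct HS as [HY [Hw _]]; specialize (Hw y); pose proof (wt_pow_pos y p) as Hp.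
specialize (Hb y (B / wt y ^ p) Hy (fun x Hx => HB y x ltac:(lra))); rewrite <- E in Hb.
unfold Rdiv; rewrite Rabs_mult, (Rabs_pos_eq (/ w y)) by (left; apply Rinv_0_lt_compat, Hw).
apply Rle_trans with (wt y ^ p * (B / wt y ^ p * w y * / w y)).
- apply Rmult_le_compat_l; [lra|]; apply Rmult_le_compat_r; [|exact Hb].
  left; apply Rinv_0_lt_compat, Hw.
- right; field; lra.
Qed.

Lemma rapid_R_reflect h : rapid_R h -> rapid_R (fun x => - h (- x)).
Proof.
intros H k; destruct (H k) as [B HB]; exists B; intros x; specialize (HB (- x)).
unfold wt in *; rewrite Rabs_Ropp in *; exact HB.
Qed.

Lemma integrating_factor_limits X w Y0 (k : R -> R) (H : R -> R) :
  integrating_factor X w Y0 -> (forall x, is_derive H x (w x * k x)) -> rapid_R k ->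
  exists L L' : R, is_lim H p_infty L /\ is_lim (fun y => H (- y)) p_infty L'.
Proof.
intros [Hr Hl] HH Hk.
destruct (rapid_R_bounded k Hk) as [C0 HC0].
destruct (tail_limit X w Y0 H k C0 Hr HH (fun x _ => HC0 x)) as [L [HL _]].
destruct (tail_limit _ _ Y0 (fun y => H (- y)) (fun y => - k (- y)) C0 Hl) as [L' [HL' _]].
- intros x; replace (w (- x) * - k (- x)) with (- (w (- x) * k (- x))) by ring.
  apply is_derive_reflect, HH.
- intros x _; rewrite Rabs_Ropp; apply HC0.
- exists L, L'; split; assumption.
Qed.

Lemma rapid_R_sub (h w : R -> R) (c : R) :
  rapid_R h -> rapid_R w -> rapid_R (fun x => h x - c * w x).
Proof.
intros Hh Hw k; destruct (Hh k) as [B HB], (Hw k) as [B' HB'].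
exists (B + Rabs c * B'); intros x; specialize (HB x); specialize (HB' x).
pose proof (wt_pow_pos x k).
assert (Ht : Rabs (h x - c * w x) <= Rabs (h x) + Rabs c * Rabs (w x)).
{ unfold Rminus; eapply Rle_trans; [apply Rabs_triang|]; rewrite Rabs_Ropp, Rabs_mult; lra. }
apply Rle_trans with (wt x ^ k * (Rabs (h x) + Rabs c * Rabs (w x))).
- apply Rmult_le_compat_l; lra.
- replace (wt x ^ k * (Rabs (h x) + Rabs c * Rabs (w x))) with
    (wt x ^ k * Rabs (h x) + Rabs c * (wt x ^ k * Rabs (w x))) by ring.
  apply Rplus_le_compat; [exact HB|]; apply Rmult_le_compat_l; [apply Rabs_pos | exact HB'].
Qed.

(** Variation of constants: [s w] is a primitive of [w (h - c w)], and it must vanish at both ends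
    for [s] to decay. The constant of integration settles one end. Equality of the two limits forces
    [c] to be the integral of [w h] over that of [w^2], the coefficient of the orthogonal projection
    of [h] on [w]. *)
Lemma ode_solvable X w Y0 (h : R -> R) :
  integrating_factor X w Y0 -> (forall y, continuous h y) -> rapid_R h ->
  exists c s, (forall y, is_derive s y (h y - c * w y - X y * s y)) /\ rapid_R s.
Proof.
intros HI Hhc Hh; pose proof HI as [Hr Hl].
pose proof (integrating_factor_rapid X w Y0 HI) as Hwr.
assert (Hwp : forall y, 0 < w y) by apply Hr.
assert (Hw' : forall y, is_derive w y (X y * w y)) by apply Hr.
assert (Hwc : forall y, continuous w y)
  by (intros y; apply (ex_derive_continuous w); eexists; apply Hw').
set (H := fun y => RInt (fun t => w t * h t) 0 y).
set (W := fun y => RInt (fun t => w t * w t) 0 y).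
assert (HH : forall y, is_derive H y (w y * h y)).
{ intros y; apply (is_derive_integral (fun t => w t * h t)).
  intros z; apply (continuous_mult w h); auto. }
assert (HW : forall y, is_derive W y (w y * w y)).
{ intros y; apply (is_derive_integral (fun t => w t * w t)).
  intros z; apply (continuous_mult w w); auto. }
destruct (integrating_factor_limits X w Y0 h H HI HH Hh) as [L [L' [HL HL']]].
destruct (integrating_factor_limits X w Y0 w W HI HW Hwr) as [V [V' [HV HV']]].
(* The difference [V - V'] is the integral of [w^2] over the line, the denominator of [c]. *)
assert (HVV : V' < V).
{ assert (Hinc : forall y z, y <= z -> W y <= W z).
  { intros y z Hyz; apply Ropp_le_cancel.
    apply (nonincreasing_right (fun t => - W t) (fun t => - (w t * w t)) y); [| |lra].
    - intros t; apply (is_derive_opp W), HW.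
    - intros t _; pose proof (Rmult_lt_0_compat _ _ (Hwp t) (Hwp t)); lra. }
  assert (H01 : W 0 < W 1).
  { apply (incr_function_le W 0 1 (fun t => w t * w t)); simpl; try lra.
    - intros x _ _; apply HW.
    - intros x _ _; apply Rmult_lt_0_compat; apply Hwp. }
  apply Rle_lt_trans with (W 0); [|apply Rlt_le_trans with (1 := H01)].
  - apply (is_lim_le_loc (fun y => W (- y)) (fun _ => W 0) p_infty V' (W 0)).
    + exists 0; intros y Hy; apply Hinc; lra.
    + exact HV'.
    + apply is_lim_const.
  - apply (is_lim_le_loc (fun _ => W 1) W p_infty (W 1) V).
    + exists 1; intros y Hy; apply Hinc; lra.
    + apply is_lim_const.
    + exact HV. }
set (c := (L - L') / (V - V')); set (G := fun y => H y - c * W y).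
set (k := fun y => h y - c * w y).
assert (Hk : rapid_R k) by (apply rapid_R_sub; assumption).
assert (HG : forall y, is_derive G y (w y * k y)).
{ intros y; unfold k; replace (w y * (h y - c * w y)) with (w y * h y - c * (w y * w y)) by ring.
  apply (is_derive_minus H (fun y => c * W y)); [apply HH | apply is_derive_scal, HW]. }
set (Lim := L - c * V).
assert (HG1 : is_lim G p_infty Lim).
{ apply (is_lim_minus' H (fun y => c * W y)); [exact HL|].
  apply (is_lim_scal_l W c p_infty V HV). }
assert (HG2 : is_lim (fun y => G (- y)) p_infty Lim).
{ replace Lim with (L' - c * V') by (unfold Lim, c; field; lra).
  apply (is_lim_minus' (fun y => H (- y)) (fun y => c * W (- y))); [exact HL'|].
  apply (is_lim_scal_l (fun y => W (- y)) c p_infty V' HV'). }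
exists c, (fun y => (G y - Lim) / w y).
assert (Hs : forall y, is_derive (fun y => (G y - Lim) / w y) y
  (h y - c * w y - X y * ((G y - Lim) / w y))).
{ intros y; pose proof (Hwp y).
  replace (h y - c * w y - X y * ((G y - Lim) / w y)) with
    ((w y * k y * w y - (G y - Lim) * (X y * w y)) / w y ^ 2)
    by (unfold k; field; lra).
  apply (is_derive_div (fun y => G y - Lim) w); [|apply Hw'|lra].
  replace (w y * k y) with (w y * k y - 0) by ring.
  apply (is_derive_minus G (fun _ => Lim)); [apply HG | apply is_derive_const_R]. }
split; [exact Hs|]; intros p.
(* Three ranges are treated apart: the right tail, the left tail by reflection, and the compact
   middle by continuity. *)
destruct (ode_rapid_right X w Y0 G k Lim p Hr HG Hk HG1) as [B1 H1].
destruct (ode_rapid_right _ _ Y0 (fun y => G (- y)) (fun y => - k (- y)) Lim p Hl) as [B2 H2].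
{ intros x; replace (w (- x) * - k (- x)) with (- (w (- x) * k (- x))) by ring.
  apply is_derive_reflect, HG. }
{ apply rapid_R_reflect, Hk. }
{ exact HG2. }
destruct (continuous_bounded (fun y => (G y - Lim) / w y) (- Y0) Y0) as [B3 [HB3 H3]].
{ intros x; apply (ex_derive_continuous (fun y => (G y - Lim) / w y)); eexists; apply Hs. }
assert (HY : 0 <= Y0) by apply Hr.
exists (Rmax B1 (Rmax B2 (wt Y0 ^ p * B3))); intros y.
pose proof (Rmax_l B1 (Rmax B2 (wt Y0 ^ p * B3))).
pose proof (Rmax_r B1 (Rmax B2 (wt Y0 ^ p * B3))).
pose proof (Rmax_l B2 (wt Y0 ^ p * B3)); pose proof (Rmax_r B2 (wt Y0 ^ p * B3)).
destruct (Rle_dec Y0 y) as [Hy|Hy]; [specialize (H1 y Hy); lra|].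
destruct (Rle_dec y (- Y0)) as [Hy'|Hy'].
- specialize (H2 (- y) ltac:(lra)); simpl in H2; rewrite Ropp_involutive in H2.
  unfold wt in H2 at 1; rewrite Rabs_Ropp in H2; fold (wt y) in H2; lra.
- apply Rle_trans with (wt Y0 ^ p * B3); [|lra].
  apply Rmult_le_compat; [left; apply wt_pow_pos | apply Rabs_pos | | apply H3; lra].
  apply pow_incr; pose proof (wt_ge1 y); split; [lra|].
  unfold wt; rewrite (Rabs_pos_eq Y0) by lra.
  apply Rplus_le_compat_l, Rabs_le; lra.
Qed.

(** For [c >= 0] the product [s w] has derivative [c w^2 >= 0], so it is monotone, and since [s] is
    bounded it tends to zero at both ends; hence it vanishes. The case [c = 0] yields injectivity,
    the general case independence modulo the range. *)
Lemma ode_unique X w Y0 (c B : R) (s : R -> R) :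
  integrating_factor X w Y0 -> (forall y, is_derive s y (c * w y - X y * s y)) ->
  (forall y, Rabs (s y) <= B) -> c = 0 /\ forall y, s y = 0.
Proof.
intros HI; pose proof HI as [Hr Hl].
assert (Hwp : forall y, 0 < w y) by apply Hr.
assert (Hw' : forall y, is_derive w y (X y * w y)) by apply Hr.
assert (Hpos : forall c s, 0 <= c -> (forall y, is_derive s y (c * w y - X y * s y)) ->
  (forall y, Rabs (s y) <= B) -> c = 0 /\ forall y, s y = 0).
{ clear c s; intros c s Hc Hs HB.
  assert (Hinc : forall y z, y <= z -> s y * w y <= s z * w z).
  { intros y z Hyz; apply Ropp_le_cancel.
    apply (nonincreasing_right (fun t => - (s t * w t)) (fun t => - (c * (w t * w t))) y);
      [| |lra].
    - intros t; apply (is_derive_opp (fun t => s t * w t)).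
      replace (c * (w t * w t)) with ((c * w t - X t * s t) * w t + s t * (X t * w t)) by ring.
      apply (is_derive_mult s w); auto; intros; apply Rmult_comm.
    - intros t _; pose proof (Rmult_lt_0_compat _ _ (Hwp t) (Hwp t)).
      assert (0 <= c * (w t * w t)) by (apply Rmult_le_pos; lra); lra. }
  assert (Habs : forall y, Rabs (s y * w y) <= B * w y).
  { intros y; rewrite Rabs_mult, (Rabs_pos_eq (w y)) by (left; apply Hwp).
    apply Rmult_le_compat_r; [left; apply Hwp | apply HB]. }
  assert (H0 : forall y, s y = 0).
  { intros y; assert (E : s y * w y = 0).
    { apply Rle_antisym.
      - apply le_epsilon; intros e He; rewrite Rplus_0_l.
        destruct (solves_right_lim _ _ _ Hr B e He) as [M [_ HM]].
        specialize (HM (Rmax M y) (Rmax_l _ _)); specialize (Hinc y (Rmax M y) (Rmax_r _ _)).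
        specialize (Habs (Rmax M y)); apply Rabs_le_between in Habs; lra.
      - apply le_epsilon; intros e He.
        destruct (solves_right_lim _ _ _ Hl B e He) as [M [_ HM]].
        specialize (HM (Rmax M (- y)) (Rmax_l _ _)).
        pose proof (Rmax_r M (- y)).
        specialize (Hinc (- Rmax M (- y)) y ltac:(lra)).
        specialize (Habs (- Rmax M (- y))); apply Rabs_le_between in Habs; lra. }
    specialize (Hwp y); apply Rmult_integral in E; destruct E; lra. }
  split; [|exact H0].
  specialize (Hs 0); rewrite H0 in Hs.
  assert (E : c * w 0 - X 0 * 0 = 0).
  { rewrite <- (is_derive_unique _ _ _ Hs); apply is_derive_unique.
    apply (is_derive_ext (fun _ => 0)); [intros; symmetry; apply H0 | apply is_derive_const_R]. }
  specialize (Hwp 0); rewrite Rmult_0_r, Rminus_0_r in E.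
  apply Rmult_integral in E; destruct E; lra. }
intros Hs HB; destruct (Rle_dec 0 c) as [Hc|Hc]; [apply Hpos; auto|].
destruct (Hpos (- c) (fun y => - s y)) as [H1 H2].
- lra.
- intros y; replace (- c * w y - X y * - s y) with (- (c * w y - X y * s y)) by ring.
  apply (is_derive_opp s), Hs.
- intros y; rewrite Rabs_Ropp; apply HB.
- split; [lra|]; intros y; specialize (H2 y); lra.
Qed.

(** * Complex-valued solutions and their regularity *)

Lemma rapid_0 (phi : R -> C) :
  rapid 0 phi <-> forall k, exists B, forall x, wt x ^ k * Cmod (phi x) <= B.
Proof.
split.
- intros [H _] k; destruct (H k) as [K [M HK]]; exists K; intros x.
  specialize (HK tt x Logic.I); lra.
- intros H; split; [|exact Logic.I]; intros k; destruct (H k) as [B HB].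
  exists B, 0%nat; intros _ x _; rewrite Rmult_1_r; apply HB.
Qed.

Lemma Cmod_components (z : C) :
  Rabs (Re z) <= Cmod z /\ Rabs (Im z) <= Cmod z /\ Cmod z <= Rabs (Re z) + Rabs (Im z).
Proof.
pose proof (Rmax_Cmod z).
pose proof (Rmax_l (Rabs (Re z)) (Rabs (Im z))); pose proof (Rmax_r (Rabs (Re z)) (Rabs (Im z))).
unfold Re, Im in *; split; [lra | split; [lra|]].
replace z with (Cplus (RtoC (fst z)) (Cmult Ci (RtoC (snd z)))) at 1.
- apply Rle_trans with (1 := Cmod_triangle _ _).
  rewrite Cmod_mult, !Cmod_R.
  replace (Cmod Ci) with 1; [lra|].
  unfold Cmod, Ci; simpl.
  replace (0 * (0 * 1) + 1 * (1 * 1)) with 1 by ring; symmetry; apply sqrt_1.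
- destruct z as [u v]; unfold Cplus, Cmult, RtoC, Ci; simpl; f_equal; ring.
Qed.

Lemma rapid_0_components (phi : R -> C) :
  rapid 0 phi <-> rapid_R (fun x => Re (phi x)) /\ rapid_R (fun x => Im (phi x)).
Proof.
rewrite rapid_0; split.
- intros H; split; intros k; destruct (H k) as [B HB]; exists B; intros x;
    apply Rle_trans with (2 := HB x), Rmult_le_compat_l;
    (left; apply wt_pow_pos) || apply Cmod_components.
- intros [H1 H2] k; destruct (H1 k) as [B1 HB1], (H2 k) as [B2 HB2].
  exists (B1 + B2); intros x.
  apply Rle_trans with (wt x ^ k * (Rabs (Re (phi x)) + Rabs (Im (phi x)))).
  + apply Rmult_le_compat_l; [left; apply wt_pow_pos | apply Cmod_components].
  + rewrite Rmult_plus_distr_l; apply Rplus_le_compat; auto.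
Qed.

Lemma ode_solvable_C X w Y0 (h : R -> C) :
  integrating_factor X w Y0 -> rapid 1 h ->
  exists (c : C) (s : R -> C),
    (forall y, cder s y (Cminus (Cminus (h y) (Cmult c (RtoC (w y)))) (Cmult (RtoC (X y)) (s y))))
    /\ rapid 0 s.
Proof.
intros HI Hh.
pose proof (decaying_0 _ _ _ _ Hh) as H0; apply rapid_0_components in H0.
destruct Hh as [_ [h' [Hd _]]], H0 as [Hr1 Hr2].
destruct (ode_solvable X w Y0 (fun x => Re (h x)) HI) as [c1 [s1 [E1 R1]]]; [|exact Hr1|].
{ intros y; apply (ex_derive_continuous (fun x => Re (h x))); eexists; apply (Hd tt). }
destruct (ode_solvable X w Y0 (fun x => Im (h x)) HI) as [c2 [s2 [E2 R2]]]; [|exact Hr2|].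
{ intros y; apply (ex_derive_continuous (fun x => Im (h x))); eexists; apply (Hd tt). }
exists (c1, c2), (fun y => (s1 y, s2 y)); split; [|apply rapid_0_components; split; assumption].
intros y; split.
- replace (Re _) with (Re (h y) - c1 * w y - X y * s1 y)
    by (unfold Cminus, Cplus, Copp, Cmult, RtoC, Re, Im; simpl; ring); apply E1.
- replace (Im _) with (Im (h y) - c2 * w y - X y * s2 y)
    by (unfold Cminus, Cplus, Copp, Cmult, RtoC, Re, Im; simpl; ring); apply E2.
Qed.

Lemma ode_unique_C X w Y0 (c : C) (s : R -> C) :
  integrating_factor X w Y0 ->
  (forall y, cder s y (Cminus (Cmult c (RtoC (w y))) (Cmult (RtoC (X y)) (s y)))) ->
  rapid 0 s -> c = RtoC 0 /\ forall y, s y = RtoC 0.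
Proof.
intros HI Hs Hr; apply rapid_0_components in Hr; destruct Hr as [R1 R2].
apply rapid_R_bounded in R1; apply rapid_R_bounded in R2.
destruct R1 as [B1 R1], R2 as [B2 R2].
destruct (ode_unique X w Y0 (Re c) B1 (fun y => Re (s y)) HI) as [C1 S1]; [|exact R1|].
{ intros y; destruct (Hs y) as [H _].
  replace (Re c * w y - X y * Re (s y)) with
    (Re (Cminus (Cmult c (RtoC (w y))) (Cmult (RtoC (X y)) (s y))));
    [exact H | unfold Cminus, Cplus, Copp, Cmult, RtoC, Re, Im; simpl; ring]. }
destruct (ode_unique X w Y0 (Im c) B2 (fun y => Im (s y)) HI) as [C2 S2]; [|exact R2|].
{ intros y; destruct (Hs y) as [_ H].
  replace (Im c * w y - X y * Im (s y)) with
    (Im (Cminus (Cmult c (RtoC (w y))) (Cmult (RtoC (X y)) (s y))));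
    [exact H | unfold Cminus, Cplus, Copp, Cmult, RtoC, Re, Im; simpl; ring]. }
split; [|intros y]; apply injective_projections;
  [exact C1 | exact C2 | apply S1 | apply S2].
Qed.

(** Bootstrapping: the equation expresses [s'] through [h] and [X s], and a tempered factor
    preserves decay, so each pass gains one derivative. *)
Lemma ode_regular X p (h s : R -> C) :
  (forall n, tempered (I := unit) everywhere p n (fun _ => X)) -> (forall n, rapid n h) ->
  (forall y, cder s y (Cminus (h y) (Cmult (RtoC (X y)) (s y)))) ->
  rapid 0 s -> forall n, rapid n s.
Proof.
intros HX Hh Hs H0; induction n as [|n IH]; [exact H0|].
split; [apply H0|].
exists (fun _ y => Cplus (h y) (Cmult (RtoC ((-1) * X y)) (s y))); split.
- intros _ y; replace (Cplus _ _) with (Cminus (h y) (Cmult (RtoC (X y)) (s y))); [apply Hs|].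
  replace ((-1) * X y) with (- X y) by ring; rewrite RtoC_opp; ring.
- apply decaying_plus; [apply antitone_everywhere | apply Hh|].
  apply (decaying_mult everywhere _ antitone_everywhere p); [|exact IH].
  apply tempered_mult; [|apply HX].
  apply (tempered_const _ 0 n (fun _ => -1) 1); intros; rewrite Rabs_left by lra; lra.
Qed.

Lemma rapid_zero (n : nat) : rapid n (fun _ => RtoC 0).
Proof.
assert (H0 : rapid 0 (fun _ => RtoC 0)).
{ apply rapid_0; intros k; exists 0; intros x; rewrite Cmod_0; lra. }
induction n as [|n IH]; [exact H0|]; split; [apply H0|].
exists (fun _ _ => RtoC 0); split; [intros; apply cder_const | exact IH].
Qed.

Lemma decaying_annihilation {I : Type} (S : nat -> I -> R -> Prop) (nu : I -> R) n F :
  antitone S -> decaying S nu (Datatypes.S n) F ->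
  decaying S nu n (fun i => annihilation (F i)).
Proof.
intros HS HF; apply decaying_plus; [exact HS| |].
- apply (decaying_mult S nu HS 1); [apply tempered_id | apply decaying_S, HF].
- apply decaying_CDerive, HF.
Qed.

(** The same bootstrapping, applied to [w' = X w]. *)
Lemma integrating_factor_schwartz X w Y0 p :
  integrating_factor X w Y0 ->
  (forall n, tempered (I := unit) everywhere p n (fun _ => X)) ->
  forall n, rapid n (fun y => RtoC (w y)).
Proof.
intros HI HX.
assert (H0 : rapid 0 (fun y => RtoC (w y))).
{ apply rapid_0_components; split; [apply (integrating_factor_rapid X w Y0 HI)|].
  intros k; exists 0; intros x; simpl; rewrite Rabs_R0; lra. }
induction n as [|n IH]; [exact H0|].
split; [apply H0|].
exists (fun _ y => Cmult (RtoC (X y)) (RtoC (w y))); split.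
- intros _ y; destruct HI as [[_ [_ [H _]]] _]; split.
  + replace (Re _) with (X y * w y) by (unfold Cmult, RtoC, Re; simpl; ring); apply H.
  + replace (Im _) with 0 by (unfold Cmult, RtoC, Im; simpl; ring); exact (is_derive_const_R 0 y).
- apply (decaying_mult everywhere _ antitone_everywhere p); [apply HX | exact IH].
Qed.

(** * Periodic coefficients and inverse square roots *)

Lemma periodic_Z {V : Type} (p : R) (h : R -> V) :
  (forall x, h (x + p) = h x) -> forall (k : Z) x, h (x + IZR k * p) = h x.
Proof.
intros Hp.
assert (Hn : forall (k : nat) x, h (x + INR k * p) = h x).
{ induction k as [|k IH]; intros x.
  - f_equal; simpl; ring.
  - rewrite S_INR, <- (IH x), <- (Hp (x + INR k * p)); f_equal; ring. }
intros k x; destruct (Z_le_dec 0 k) as [Hk|Hk].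
- rewrite <- (Z2Nat.id k Hk), <- INR_IZR_INZ; apply Hn.
- rewrite <- (Hn (Z.to_nat (- k)) (x + IZR k * p)); f_equal.
  rewrite INR_IZR_INZ, Z2Nat.id, opp_IZR by lia; ring.
Qed.

Lemma periodic_bounded (p : R) (h : R -> R) :
  0 < p -> (forall x, h (x + p) = h x) -> (forall x, continuous h x) ->
  exists B, 0 <= B /\ forall x, Rabs (h x) <= B.
Proof.
intros Hp Hper Hc; destruct (continuous_bounded h 0 p Hc) as [B [HB H]].
exists B; split; [exact HB|]; intros x.
rewrite <- (periodic_Z p h Hper (- fl p x) x).
apply H; destruct (fl_cell p x Hp); rewrite opp_IZR; lra.
Qed.

Lemma smooth_periodic_tempered (p : R) (h : R -> R) (n : nat) :
  0 < p -> smooth_periodic p h ->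
  tempered (I := unit) everywhere 0 n (fun _ => h).
Proof.
intros Hp [Hd Hper].
enough (H : forall n j, tempered (I := unit) everywhere 0 n (fun _ => Derive_n h j))
  by exact (H n 0%nat).
clear n; induction n as [|n IH]; intros j; split.
1,3: destruct (periodic_bounded p (Derive_n h j) Hp) as [B [HB H]];
  [ intros x; rewrite <- Derive_n_comp_trans; apply Derive_n_ext, Hper
  | intros x; apply (ex_derive_continuous (Derive_n h j)), (Hd (Datatypes.S j))
  | exists B; split; [exact HB|]; intros _ x _; simpl; rewrite Rmult_1_r; apply H ].
- exact Logic.I.
- exists (fun _ => Derive_n h (Datatypes.S j)); split; [|apply IH].
  intros _ x; apply Derive_correct, (Hd (Datatypes.S j)).
Qed.

(** Writing [w] for the inverse square root, [w' = - h' w^3]: the derivative is a product of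
    functions already known to be bounded to one order less. Nonnegativity of [h] keeps the root at
    least [1]. *)
Lemma tempered_inv_sqrt (h : R -> R) (n : nat) :
  (forall x, 0 <= h x) -> tempered (I := unit) everywhere 0 n (fun _ => h) ->
  tempered (I := unit) everywhere 0 n (fun _ x => / sqrt (1 + 2 * h x)).
Proof.
intros Hpos.
assert (H0 : forall x, 1 <= sqrt (1 + 2 * h x)).
{ intros x; rewrite <- sqrt_1 at 1; apply sqrt_le_1_alt; specialize (Hpos x); lra. }
induction n as [|n IH]; intros Hh; split.
1,3: exists 1; split; [lra|]; intros _ x _; specialize (H0 x);
  rewrite Rabs_pos_eq by (left; apply Rinv_0_lt_compat; lra);
  rewrite pow_O, Rmult_1_r; apply Rle_trans with (/ 1); [apply Rinv_le_contravar|]; lra.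
- exact Logic.I.
- specialize (IH (tempered_S _ _ _ _ Hh)); destruct Hh as [_ [h' [H1 H2]]].
  set (w := fun x => / sqrt (1 + 2 * h x)) in *.
  exists (fun i x => (-1) * h' i x * (w x * (w x * w x))); split.
  + intros i x; specialize (H1 i x); specialize (H0 x).
    replace ((-1) * h' i x * (w x * (w x * w x))) with
      (- (2 * h' i x / (2 * sqrt (1 + 2 * h x))) / sqrt (1 + 2 * h x) ^ 2)
      by (unfold w; field; lra).
    apply (is_derive_inv (fun x => sqrt (1 + 2 * h x))); [|lra].
    apply (is_derive_sqrt (fun x => 1 + 2 * h x)); [|specialize (Hpos x); lra].
    replace (2 * h' i x) with (0 + 2 * h' i x) by ring.
    apply (is_derive_plus (fun _ => 1) (fun x => 2 * h x)); [apply is_derive_const_R|].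
    apply is_derive_scal, H1.
  + apply tempered_mult.
    * apply tempered_mult; [|exact H2].
      apply (tempered_const _ 0 n (fun _ => -1) 1); intros; rewrite Rabs_left by lra; lra.
    * apply tempered_mult; [exact IH|]; apply tempered_mult; exact IH.
Qed.

(** * The chains of arcs *)

(* Here [1 = N theta + a], so that translation by [1] moves the arc number [n] to the
   arc number [n + N], shifted by [a]. *)
Record rieffel_setup (theta eps a : R) (N : Z) (f g : R -> R) : Prop := {
  rs_theta : 0 < theta < 1;
  rs_eps : 0 < eps < a;
  rs_a : a + eps < theta;
  rs_N : (1 <= N)%Z;
  rs_one : IZR N * theta + a = 1;
  rs_f : smooth_periodic theta f;
  rs_g : smooth_periodic theta g;
  rs_f01 : forall x, 0 <= f x <= 1;
  rs_f1 : forall x, eps <= x <= a -> f x = 1;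
  rs_f0 : forall x, a + eps <= x <= theta -> f x = 0;
  rs_fflip : forall x, 0 < x < eps -> f x = 1 - f (x + 1);
  rs_gsqrt : forall x, 0 <= x <= eps -> g x = sqrt (f x - f x ^ 2);
  rs_g0 : forall x, eps <= x <= theta -> g x = 0 }.

Lemma rieffel_data_setup (theta eps : R) (f g : R -> R) :
  0 < theta < 1 -> rieffel_data theta eps f g ->
  rieffel_setup theta eps (theta * frac_part (1 / theta)) (Int_part (1 / theta)) f g.
Proof.
intros Ht [H1 [H2 [H3 [H4 [H5 [H6 [H7 [H8 [H9 [H10 H11]]]]]]]]]].
constructor; auto.
- destruct (base_Int_part (1 / theta)) as [_ Hb].
  assert (1 < 1 / theta).
  { apply Rmult_lt_reg_r with theta; [lra|].
    replace (1 / theta * theta) with 1 by (field; lra); lra. }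
  assert (0 < Int_part (1 / theta))%Z by (apply lt_IZR; lra); lia.
- unfold frac_part; field; lra.
Qed.

(** Indices that differ by a multiple of [N] name the same line, seen with its origin moved by a
    multiple of [a]. Allowing every integer index avoids a wrap-around whenever translation by [1]
    adds [N] to the arc number. *)
Definition equivariant {V : Type} (a : R) (N : Z) (s : Z -> R -> V) : Prop :=
  forall n m y, s (n - m * N)%Z y = s n (y + IZR m * a).

Lemma equivariant_cder (a : R) (N : Z) (s s' : Z -> R -> C) :
  equivariant a N s -> (forall n y, cder (s n) y (s' n y)) -> equivariant a N s'.
Proof.
intros He Hs n m y; apply (cder_unique (s (n - m * N)%Z) y); [apply Hs|].
replace (s (n - m * N)%Z) with (fun t => s n (t + IZR m * a))
  by (extensionality t; symmetry; apply He).
apply (cder_shift (s n)), Hs.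
Qed.

Section Chains.
Context {theta eps a : R} {N : Z} {f g : R -> R}
  (RS : rieffel_setup theta eps a N f g).

Let al (x : R) : R := sqrt (f x).
Let be (x : R) : R := sqrt (1 - f x).

(** The plateaus [[eps, a]] and [[a + eps, theta]] of [f] have lengths [a - eps] and
    [theta - a - eps]. Identities known on the overlap [[0, eps]] extend by this much on both sides,
    which gives the open neighbourhoods needed for gluing and differentiating. *)
Definition margin : R := Rmin (a - eps) (theta - a - eps).

Lemma margin_spec : 0 < margin /\ margin <= a - eps /\ margin <= theta - a - eps.
Proof.
destruct RS as [? ? ?]; unfold margin.
split; [apply Rmin_pos; lra | split; [apply Rmin_l | apply Rmin_r]].
Qed.

Lemma f_periodic (k : Z) (x : R) : f (x + IZR k * theta) = f x.
Proof. apply periodic_Z, (rs_f _ _ _ _ _ _ RS). Qed.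

Lemma g_periodic (k : Z) (x : R) : g (x + IZR k * theta) = g x.
Proof. apply periodic_Z, (rs_g _ _ _ _ _ _ RS). Qed.

Lemma f_add_one (x : R) : f (x + 1) = f (x + a).
Proof. rewrite <- (f_periodic N (x + a)); f_equal; rewrite <- (rs_one _ _ _ _ _ _ RS); ring. Qed.

Lemma f_left (x : R) : - margin <= x <= 0 -> f x = 0.
Proof.
intros Hx; pose proof margin_spec; pose proof (rs_eps _ _ _ _ _ _ RS).
rewrite <- (f_periodic 1 x); apply (rs_f0 _ _ _ _ _ _ RS); lra.
Qed.

(** Inside the overlap this is the defining relation of [f], translation by [1] being translation by
    [a] modulo [theta]. Outside it both sides are constant, equal to [0] or [1]. *)
Lemma f_flip (x : R) : - margin <= x <= eps + margin -> f (x + a) = 1 - f x.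
Proof.
intros Hx; pose proof margin_spec; pose proof (rs_eps _ _ _ _ _ _ RS).
destruct (Rle_dec x 0) as [H1|H1].
{ rewrite (f_left x), (rs_f1 _ _ _ _ _ _ RS) by lra; ring. }
destruct (Rlt_dec x eps) as [H2|H2].
{ rewrite (rs_fflip _ _ _ _ _ _ RS x), f_add_one by lra; ring. }
rewrite (rs_f1 _ _ _ _ _ _ RS x), (rs_f0 _ _ _ _ _ _ RS) by lra; ring.
Qed.

Lemma al_be_sqr (x : R) : al x * al x = f x /\ be x * be x = 1 - f x.
Proof.
pose proof (rs_f01 _ _ _ _ _ _ RS x); split; apply sqrt_sqrt; lra.
Qed.

Lemma al_be_nonneg (x : R) : 0 <= al x /\ 0 <= be x.
Proof. split; apply sqrt_pos. Qed.

Lemma sqrt_ff (x : R) : sqrt (f x - f x ^ 2) = al x * be x.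
Proof.
pose proof (rs_f01 _ _ _ _ _ _ RS x); unfold al, be.
rewrite <- sqrt_mult by lra; f_equal; ring.
Qed.

Lemma al_periodic (k : Z) (x : R) : al (x + IZR k * theta) = al x.
Proof. unfold al; rewrite f_periodic; reflexivity. Qed.

Lemma be_periodic (k : Z) (x : R) : be (x + IZR k * theta) = be x.
Proof. unfold be; rewrite f_periodic; reflexivity. Qed.

Lemma al_left (x : R) : - margin <= x <= 0 -> al x = 0 /\ be x = 1.
Proof.
intros H; unfold al, be; rewrite (f_left x H), Rminus_0_r, sqrt_0, sqrt_1; auto.
Qed.

Lemma al_mid (x : R) : eps <= x <= a -> al x = 1 /\ be x = 0.
Proof.
intros H; unfold al, be; rewrite (rs_f1 _ _ _ _ _ _ RS x H), Rminus_diag, sqrt_0, sqrt_1; auto.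
Qed.

Lemma al_right (x : R) : a + eps <= x <= theta -> al x = 0.
Proof.
intros H; unfold al; rewrite (rs_f0 _ _ _ _ _ _ RS x H), sqrt_0; auto.
Qed.

Lemma al_flip (x : R) :
  - margin <= x <= eps + margin -> al (x + a) = be x /\ be (x + a) = al x.
Proof.
intros H; unfold al, be; rewrite (f_flip x H); split; [reflexivity|f_equal; ring].
Qed.

Lemma reduce_mod_theta (x : R) :
  exists (k : Z) r, x = r + IZR k * theta /\ 0 <= r < theta /\ cell theta 0 k x.
Proof.
pose proof (rs_theta _ _ _ _ _ _ RS).
destruct (fl_cell theta x ltac:(lra)) as [H1 H2].
exists (fl theta x), (x - IZR (fl theta x) * theta).
split; [ring | split; [lra | split; assumption]].
Qed.

Lemma g_sub_one (r : R) (k : Z) : g (r + IZR k * theta - 1) = g (r - a).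
Proof.
rewrite <- (g_periodic (k - N) (r - a)); f_equal.
rewrite minus_IZR, <- (rs_one _ _ _ _ _ _ RS); ring.
Qed.

Lemma g_cases (r : R) : 0 <= r < theta ->
  (r <= eps -> g r = al r * be r /\ g (r - a) = 0) /\
  (eps <= r <= a -> g r = 0 /\ g (r - a) = 0) /\
  (a <= r <= a + eps -> g r = 0 /\ g (r - a) = al (r - a) * be (r - a)) /\
  (a + eps <= r -> g r = 0 /\ g (r - a) = 0).
Proof.
intros Hr; pose proof (rs_eps _ _ _ _ _ _ RS); pose proof (rs_a _ _ _ _ _ _ RS).
assert (Hm : 0 <= r <= a -> g (r - a) = 0).
{ intros Hra; rewrite <- (g_periodic 1); apply (rs_g0 _ _ _ _ _ _ RS); lra. }
repeat split; intros.
all: try (apply Hm; lra).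
all: try (apply (rs_g0 _ _ _ _ _ _ RS); lra).
all: rewrite <- sqrt_ff; apply (rs_gsqrt _ _ _ _ _ _ RS); lra.
Qed.

(** On an arc [g] lives on the left overlap and its translate on the right one; elsewhere [al] or
    [be] vanishes. The product [al be] is thereby seen to be smooth. *)
Lemma g_plus_shift (x : R) : g x + g (x - 1) = al x * be x.
Proof.
destruct (reduce_mod_theta x) as [k [r [-> [Hr _]]]].
rewrite g_periodic, g_sub_one, al_periodic, be_periodic.
pose proof (rs_eps _ _ _ _ _ _ RS); pose proof margin_spec.
destruct (g_cases r Hr) as [H1 [H2 [H3 H4]]].
destruct (Rle_dec r eps) as [C1|C1].
{ destruct (H1 C1) as [-> ->]; ring. }
destruct (Rle_dec r a) as [C2|C2].
{ destruct H2 as [-> ->]; [lra|]; destruct (al_mid r) as [_ ->]; [lra|ring]. }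
destruct (Rle_dec r (a + eps)) as [C3|C3].
{ destruct H3 as [-> ->]; [lra|].
  destruct (al_flip (r - a)) as [<- <-]; [lra|].
  replace (r - a + a) with r by ring; ring. }
destruct H4 as [-> ->]; [lra|]; rewrite (al_right r) by lra; ring.
Qed.

Lemma f_tempered n : tempered (I := unit) everywhere 0 n (fun _ => f).
Proof.
apply (smooth_periodic_tempered theta); [apply (rs_theta _ _ _ _ _ _ RS) | apply (rs_f _ _ _ _ _ _ RS)].
Qed.

Lemma g_tempered n : tempered (I := unit) everywhere 0 n (fun _ => g).
Proof.
apply (smooth_periodic_tempered theta); [apply (rs_theta _ _ _ _ _ _ RS) | apply (rs_g _ _ _ _ _ _ RS)].
Qed.

(* With [c = al be = g + g(. - 1)] smooth, [al] and [be] are smooth even where they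
   vanish: [(al + be)^2 = 1 + 2 c] gives [al = (f + c) / sqrt (1 + 2 c)]. *)
Lemma al_be_tempered n :
  tempered (I := unit) everywhere 0 n (fun _ => al) /\
  tempered (I := unit) everywhere 0 n (fun _ => be).
Proof.
set (c := fun x => g x + g (x - 1)).
assert (Hc : tempered (I := unit) everywhere 0 n (fun _ => c)).
{ apply tempered_plus; [apply g_tempered|].
  apply (tempered_reindex everywhere n (fun _ => g) (fun u : unit => u) (fun _ => -1)).
  apply g_tempered. }
assert (Hcpos : forall x, 0 <= c x).
{ intros x; unfold c; rewrite g_plus_shift; destruct (al_be_nonneg x).
  apply Rmult_le_pos; assumption. }
pose proof (tempered_inv_sqrt c n Hcpos Hc) as Hw.
assert (Hsum : forall x, sqrt (1 + 2 * c x) = al x + be x /\ 0 < al x + be x).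
{ intros x; destruct (al_be_sqr x) as [E1 E2], (al_be_nonneg x) as [P1 P2].
  unfold c; rewrite g_plus_shift; split.
  - apply sqrt_lem_1; [|lra|nra].
    assert (0 <= al x * be x) by (apply Rmult_le_pos; assumption); lra.
  - destruct (Rle_lt_or_eq_dec _ _ P1) as [H|H]; [lra|].
    destruct (Rle_lt_or_eq_dec _ _ P2) as [H'|H']; [lra|].
    rewrite <- H in E1; rewrite <- H' in E2; lra. }
split.
- replace (fun _ : unit => al) with
    (fun (_ : unit) x => / sqrt (1 + 2 * c x) * (f x + c x)).
  + apply tempered_mult; [exact Hw|]; apply tempered_plus; [apply f_tempered | exact Hc].
  + extensionality u; extensionality x; destruct (Hsum x) as [-> H], (al_be_sqr x) as [<- _].
    unfold c; rewrite g_plus_shift; field; lra.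
- replace (fun _ : unit => be) with
    (fun (_ : unit) x => / sqrt (1 + 2 * c x) * ((1 + (-1) * f x) + c x)).
  + apply tempered_mult; [exact Hw|]; apply tempered_plus; [|exact Hc].
    apply tempered_plus.
    * apply (tempered_const _ 0 n (fun _ => 1) 1); intros; rewrite Rabs_R1; lra.
    * apply tempered_mult; [|apply f_tempered].
      apply (tempered_const _ 0 n (fun _ => -1) 1); intros; rewrite Rabs_left by lra; lra.
  + extensionality u; extensionality x; destruct (Hsum x) as [-> H], (al_be_sqr x) as [_ E].
    unfold c; rewrite g_plus_shift; replace (1 + (-1) * f x) with (1 - f x) by ring.
    rewrite <- E; field; lra.
Qed.

(** Since [m a = m - m N theta], the coordinate [y = r + m a] corresponds to the point
    [r + (n - m N) theta] of the real line. Its translate by [1] lies in the arc numbered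
    [n - (m - 1) N], at coordinate [r + a]; these are the two points identified in the gluing. *)
Definition arc_piece (phi : R -> C) (n m : Z) (y : R) : C :=
  Cplus (Cmult (RtoC (al (y - IZR m * a))) (phi (y + (IZR n * theta - IZR m))))
        (Cmult (RtoC (be (y - IZR m * a))) (phi (y + (IZR n * theta + 1 - IZR m)))).

(* The arcs number [n], [n - N], [n - 2 N], ... are laid end to end on a line: an arc
   overlaps the next one on an interval of length [eps], with weights [al] and [be]. *)
Definition chain (phi : R -> C) (n : Z) : R -> C := glue a (arc_piece phi n).

(** The weight is common to all pieces and vanishes just left of each multiple of [theta], so
    consecutive pieces match there whatever the family is. *)
Definition unchain_piece (s : Z -> R -> C) (n : Z) (x : R) : C :=
  Cmult (RtoC (al x)) (s n (x + - (IZR n * theta))).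

Definition unchain (s : Z -> R -> C) : R -> C := glue theta (unchain_piece s).

Lemma chain_at (phi : R -> C) (n m : Z) (r : R) :
  0 <= r < a ->
  chain phi n (r + IZR m * a) =
    Cplus (Cmult (RtoC (al r)) (phi (r + IZR (n - m * N) * theta)))
          (Cmult (RtoC (be r)) (phi (r + IZR (n - m * N) * theta + 1))).
Proof.
intros Hr; unfold chain; rewrite (glue_cell a _ m) by lra.
unfold arc_piece; rewrite minus_IZR, mult_IZR.
pose proof (rs_one _ _ _ _ _ _ RS) as H1.
assert (E : IZR m * a = IZR m - IZR m * IZR N * theta).
{ replace (IZR m - IZR m * IZR N * theta) with (IZR m * (1 - IZR N * theta)) by ring.
  rewrite <- H1; ring. }
replace (r + IZR m * a - IZR m * a) with r by ring.
replace (r + IZR m * a + (IZR n * theta - IZR m)) with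
  (r + (IZR n - IZR m * IZR N) * theta) by (rewrite E; ring).
replace (r + IZR m * a + (IZR n * theta + 1 - IZR m)) with
  (r + (IZR n - IZR m * IZR N) * theta + 1) by (rewrite E; ring).
reflexivity.
Qed.

Lemma reduce_mod_a (y : R) : exists (m : Z) r, y = r + IZR m * a /\ 0 <= r < a.
Proof.
pose proof (rs_eps _ _ _ _ _ _ RS).
destruct (fl_cell a y ltac:(lra)) as [H1 H2].
exists (fl a y), (y - IZR (fl a y) * a); split; [ring | lra].
Qed.

Lemma chain_equivariant (phi : R -> C) : equivariant a N (chain phi).
Proof.
intros n m y; destruct (reduce_mod_a y) as [k [r [-> Hr]]].
rewrite chain_at by exact Hr.
replace (r + IZR k * a + IZR m * a) with (r + IZR (k + m) * a) by (rewrite plus_IZR; ring).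
rewrite chain_at by exact Hr.
replace (n - m * N - k * N)%Z with (n - (k + m) * N)%Z by ring; reflexivity.
Qed.

Lemma unchain_at (s : Z -> R -> C) (k : Z) (r : R) :
  0 <= r < theta -> unchain s (r + IZR k * theta) = Cmult (RtoC (al r)) (s k r).
Proof.
intros Hr; pose proof (rs_theta _ _ _ _ _ _ RS).
unfold unchain; rewrite (glue_cell theta _ k) by lra.
unfold unchain_piece; rewrite al_periodic; do 3 f_equal; ring.
Qed.

Lemma equivariant_add {V : Type} (s : Z -> R -> V) (k : Z) (r : R) :
  equivariant a N s -> s (k + N)%Z (r + a) = s k r.
Proof.
intros Hs; specialize (Hs (k + N)%Z 1%Z r).
replace (k + N - 1 * N)%Z with k in Hs by ring; rewrite Hs; f_equal; ring.
Qed.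

Lemma add_one_eq (r : R) (k : Z) : r + IZR k * theta + 1 = (r + a) + IZR (k + N) * theta.
Proof. rewrite plus_IZR, <- (rs_one _ _ _ _ _ _ RS) at 1; ring. Qed.

(** This is [T T^* = P]. An arc splits into left overlap, plateau, right overlap and gap; on the
    overlaps the coefficients of [P] are [al^2] and [al be], the entries of the rank one projection
    on the vector [(al, be)]. *)
Lemma rieffel_op_unchain_chain (phi : R -> C) (x : R) :
  rieffel_op f g phi x = unchain (chain phi) x.
Proof.
destruct (reduce_mod_theta x) as [k [r [-> [Hr _]]]].
rewrite unchain_at by exact Hr.
unfold rieffel_op, Uinv, U, mult_by.
rewrite g_sub_one, g_periodic, f_periodic.
pose proof (rs_eps _ _ _ _ _ _ RS); pose proof margin_spec.
destruct (g_cases r Hr) as [H1 [H2 [H3 H4]]], (al_be_sqr r) as [<- _].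
assert (Hc : 0 <= r < a -> chain phi k r =
  Cplus (Cmult (RtoC (al r)) (phi (r + IZR k * theta)))
        (Cmult (RtoC (be r)) (phi (r + IZR k * theta + 1)))).
{ intros Hra; pose proof (chain_at phi k 0 r Hra) as E.
  replace (r + IZR 0 * a) with r in E by (simpl; ring).
  replace (k - 0 * N)%Z with k in E by ring; exact E. }
(* Past [a] the coordinate falls into the next cell of the chain, at [r - a], where [al] and [be]
   have exchanged their values. *)
assert (Hc' : 0 <= r - a <= eps -> chain phi k r =
  Cplus (Cmult (RtoC (be r)) (phi (r + IZR k * theta - 1)))
        (Cmult (RtoC (al r)) (phi (r + IZR k * theta)))).
{ intros Hra; pose proof (chain_at phi k 1 (r - a) ltac:(lra)) as E.
  replace (r - a + IZR 1 * a) with r in E by (simpl; ring).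
  replace (k - 1 * N)%Z with (k - N)%Z in E by ring.
  destruct (al_flip (r - a)) as [E1 E2]; [lra|].
  replace (r - a + a) with r in E1, E2 by ring; rewrite <- E1, <- E2 in E.
  rewrite E; pose proof (rs_one _ _ _ _ _ _ RS) as Hone.
  replace (r - a + IZR (k - N) * theta) with (r + IZR k * theta - 1)
    by (rewrite minus_IZR, <- Hone; ring).
  replace (r + IZR k * theta - 1 + 1) with (r + IZR k * theta) by ring.
  reflexivity. }
destruct (Rle_dec r eps) as [C1|C1].
{ destruct (H1 C1) as [-> ->]; rewrite Hc by lra; rewrite !RtoC_mult; ring. }
destruct (Rlt_dec r a) as [C2|C2].
{ destruct H2 as [-> ->]; [lra|]; rewrite Hc by lra.
  destruct (al_mid r) as [-> ->]; [lra|]; rewrite Rmult_1_r; ring. }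
destruct (Rle_dec r (a + eps)) as [C3|C3].
{ destruct H3 as [-> ->]; [lra|]; rewrite Hc' by lra.
  destruct (al_flip (r - a)) as [<- <-]; [lra|].
  replace (r - a + a) with r by ring; rewrite !RtoC_mult; ring. }
destruct H4 as [-> ->]; [lra|]; rewrite (al_right r) by lra.
rewrite Rmult_0_l; ring.
Qed.

(** This is [T^* T = 1]. Equivariance makes both glued points carry the same value of [s], with
    total weight [al^2 + be^2 = 1]. *)
Lemma chain_unchain (s : Z -> R -> C) (n : Z) (y : R) :
  equivariant a N s -> chain (unchain s) n y = s n y.
Proof.
intros Hs; destruct (reduce_mod_a y) as [m [r [-> Hr]]].
rewrite chain_at, <- Hs by exact Hr; set (k := (n - m * N)%Z).
pose proof (rs_a _ _ _ _ _ _ RS); pose proof (rs_eps _ _ _ _ _ _ RS); pose proof margin_spec.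
rewrite unchain_at by lra.
destruct (al_be_sqr r) as [E1 E2].
destruct (Rle_dec r eps) as [C1|C1].
- rewrite add_one_eq, unchain_at, equivariant_add by (exact Hs || lra).
  destruct (al_flip r) as [-> _]; [lra|].
  replace (s k r) with (Cmult (RtoC (al r * al r + be r * be r)) (s k r)) at 3.
  + rewrite RtoC_plus, !RtoC_mult; ring.
  + rewrite E1, E2; replace (f r + (1 - f r)) with 1 by ring; ring.
- destruct (al_mid r) as [-> ->]; [lra|]; ring.
Qed.

(** Just left of a junction one weight is [0] and the other [1] in either piece, and both pieces
    reduce to the same translate of [phi]. *)
Lemma arc_piece_agree (phi : R -> C) (n : Z) : agree a (arc_piece phi n).
Proof.
pose proof margin_spec; exists margin; split; [lra|]; intros m x Hx.
unfold arc_piece; rewrite !minus_IZR.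
replace (x - (IZR m - 1) * a) with (x - IZR m * a + a) by ring.
destruct (al_flip (x - IZR m * a)) as [-> ->];
  [pose proof (rs_eps _ _ _ _ _ _ RS); lra|].
destruct (al_left (x - IZR m * a)) as [-> ->]; [lra|].
replace (IZR n * theta - (IZR m - 1)) with (IZR n * theta + 1 - IZR m) by ring.
ring.
Qed.

Lemma unchain_piece_agree (s : Z -> R -> C) : agree theta (unchain_piece s).
Proof.
pose proof margin_spec; exists margin; split; [lra|]; intros m x Hx.
unfold unchain_piece.
replace (al x) with 0; [ring|].
replace x with (x - IZR m * theta + IZR m * theta) by ring.
rewrite al_periodic; symmetry; apply al_left; lra.
Qed.

(** * Rapid decay under [chain] and [unchain] *)

Lemma a_bounds : 0 < a < 1.
Proof.
pose proof (rs_eps _ _ _ _ _ _ RS); pose proof (rs_theta _ _ _ _ _ _ RS).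
pose proof (rs_a _ _ _ _ _ _ RS); lra.
Qed.

(** On cell [m] the integer [m] is about [y / a], so the shifted point is about [- y (1 - a) / a].
    As [a < 1] its size is comparable to that of [y], uniformly in [m]. *)
Lemma arc_shift_weight (c y : R) (m : Z) :
  IZR m * a <= y < IZR m * a + a ->
  wt y <= (1 + (Rabs c + 1) / (1 - a)) * wt (y + (c - IZR m)).
Proof.
intros Hy; pose proof a_bounds as Ha; unfold wt.
set (z := y + (c - IZR m)); pose proof (Rabs_pos z); pose proof (Rabs_pos c).
assert (E : y * (1 - a) = c * a + (y - IZR m * a) - a * z) by (unfold z; ring).
assert (Hz : Rabs (a * z) <= Rabs z).
{ rewrite Rabs_mult, (Rabs_pos_eq a) by lra.
  rewrite <- (Rmult_1_l (Rabs z)) at 2; apply Rmult_le_compat_r; lra. }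
assert (Hc : Rabs (c * a) <= Rabs c).
{ rewrite Rabs_mult, (Rabs_pos_eq a) by lra.
  rewrite <- (Rmult_1_r (Rabs c)) at 2; apply Rmult_le_compat_l; lra. }
apply Rabs_le_between in Hz; apply Rabs_le_between in Hc.
assert (Hb : Rabs y * (1 - a) <= Rabs c + 1 + Rabs z).
{ rewrite <- (Rabs_pos_eq (1 - a)) at 1 by lra; rewrite <- Rabs_mult, E.
  apply Rabs_le; lra. }
apply Rmult_le_reg_r with (1 - a); [lra|].
replace ((1 + (Rabs c + 1) / (1 - a)) * (1 + Rabs z) * (1 - a)) with
  ((1 - a) * (1 + Rabs z) + (Rabs c + 1) * (1 + Rabs z)) by (field; lra).
assert (0 <= (1 - a) * Rabs z) by (apply Rmult_le_pos; lra).
assert (0 <= Rabs c * Rabs z) by (apply Rmult_le_pos; lra).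
lra.
Qed.

Lemma chain_rapid (k : nat) (phi : R -> C) (n : Z) :
  rapid k phi -> rapid k (chain phi n).
Proof.
intros Hphi; pose proof a_bounds as Ha.
apply glue_rapid; [lra | apply arc_piece_agree|].
assert (Hkappa : forall c, 0 <= 1 + (Rabs c + 1) / (1 - a)).
{ intros c; pose proof (Rabs_pos c).
  assert (0 <= (Rabs c + 1) / (1 - a)); [|lra].
  apply Rmult_le_pos; [lra|]; left; apply Rinv_0_lt_compat; lra. }
assert (Hsh : forall c, decaying (cell a) (fun _ => 1) k
  (fun m y => phi (y + (c - IZR m)))).
{ intros c.
  apply (decaying_reindex everywhere (cell a) (fun _ => 1) k (fun _ => phi)
    (fun _ => tt) (fun m => c - IZR m) _ (Hkappa c)); [|exact Hphi].
  intros N' m y Hy; split; [exact Logic.I | apply arc_shift_weight, Hy]. }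
apply decaying_plus; [apply antitone_cell| |].
- apply (decaying_mult (cell a) _ (antitone_cell a) 0); [|apply Hsh].
  apply (tempered_reindex (cell a) k (fun _ => al) (fun _ => tt) (fun m => - (IZR m * a))).
  apply al_be_tempered.
- apply (decaying_mult (cell a) _ (antitone_cell a) 0); [|apply Hsh].
  apply (tempered_reindex (cell a) k (fun _ => be) (fun _ => tt) (fun m => - (IZR m * a))).
  apply al_be_tempered.
Qed.

Lemma finite_bound (Q : Z -> R -> Prop) (M : nat) :
  (forall j K K', K <= K' -> Q j K -> Q j K') -> (forall j, exists K, Q j K) ->
  exists K, forall j, (0 <= j < Z.of_nat M)%Z -> Q j K.
Proof.
intros Hm HQ; induction M as [|M [K HK]].
- exists 0; intros j Hj; lia.
- destruct (HQ (Z.of_nat M)) as [K' HK']; exists (Rmax K K'); intros j Hj.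
  destruct (Z.eq_dec j (Z.of_nat M)) as [->|Hne].
  + apply (Hm _ K'); [apply Rmax_r | exact HK'].
  + apply (Hm _ K); [apply Rmax_l | apply HK; lia].
Qed.

(** The given bounds for different [s j] need not be uniform; after reduction modulo [N] only
    finitely many of them occur and their maximum serves. *)
Lemma decaying_mod (k : nat) (s : Z -> R -> C) :
  (forall j, rapid k (s j)) ->
  decaying everywhere (fun _ => 1) k (fun n => s (n mod N)%Z).
Proof.
pose proof (rs_N _ _ _ _ _ _ RS) as HN.
revert s; induction k as [|k IH]; intros s Hs; split.
1,3: intros p;
  destruct (finite_bound (fun j K => forall x, wt x ^ p * Cmod (s j x) <= K) (Z.to_nat N))
    as [K HK];
  [ intros j K K' HKK H x; apply Rle_trans with (1 := H x); exact HKK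
  | intros j; destruct (Hs j) as [Hj _]; destruct (Hj p) as [K [M HK]]; exists K; intros x;
    specialize (HK tt x Logic.I); lra
  | exists K, 0%nat; intros n x _; rewrite Rmult_1_r; apply HK;
    rewrite Z2Nat.id by lia; apply Z.mod_pos_bound; lia ].
- exact Logic.I.
- exists (fun n => CDerive (s (n mod N)%Z)); split.
  + intros n x; destruct (decaying_CDerive _ _ _ _ (Hs (n mod N)%Z)) as [H _].
    exact (H tt x).
  + apply (IH (fun j => CDerive (s j))); intros j.
    exact (proj2 (decaying_CDerive _ _ _ _ (Hs j))).
Qed.

Lemma unchain_rapid (k : nat) (s : Z -> R -> C) :
  equivariant a N s -> (forall j, rapid k (s j)) -> rapid k (unchain s).
Proof.
intros He Hs; pose proof a_bounds as Ha; pose proof (rs_theta _ _ _ _ _ _ RS) as Ht.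
pose proof (rs_N _ _ _ _ _ _ RS) as HN; pose proof (rs_one _ _ _ _ _ _ RS) as Hone.
apply glue_rapid; [lra | apply unchain_piece_agree|].
apply (decaying_mult (cell theta) _ (antitone_cell theta) 0).
{ assert (H : tempered (cell theta) 0 k (fun (_ : Z) x => al (x + 0))).
  { apply (tempered_reindex (cell theta) k (fun _ => al) (fun _ => tt) (fun _ => 0)).
    apply al_be_tempered. }
  replace (fun (_ : Z) x => al x) with (fun (_ : Z) x => al (x + 0)); [exact H|].
  extensionality m; extensionality x; f_equal; ring. }
(* Arc [n] is moved to the line numbered [n mod N]: first to its own coordinate, then by the shift
   that equivariance prescribes for [n / N] turns. *)
set (b := fun n : Z => - (IZR n * theta) - IZR (n / N) * a).
replace (fun n x => s n (x + - (IZR n * theta))) with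
  (fun n x => s (n mod N)%Z (x + b n)).
2:{ extensionality n; extensionality x.
  replace (n mod N)%Z with (n - (n / N) * N)%Z
    by (rewrite (Z.div_mod n N) at 1 by lia; ring).
  rewrite He; f_equal; unfold b; ring. }
(* With [z] the coordinate on the line, [Rabs x] is at most [IZR N + Rabs d + 1], where [d = n / N]
   satisfies [Rabs d <= (1 + Rabs z) / a]; the constant collects these terms. *)
apply (decaying_reindex everywhere (cell theta) (fun _ => 1) k
  (fun n => s (n mod N)%Z) (fun n => n) b (IZR N + 2 + 1 / a));
  [| |apply decaying_mod, Hs].
{ assert (0 < 1 / a) by (apply Rdiv_lt_0_compat; lra).
  assert (1 <= IZR N) by (apply IZR_le, HN); lra. }
intros N' n x [Hx1 Hx2]; split; [exact Logic.I|].
set (z := x + b n); set (d := IZR (n / N)); set (j := IZR (n mod N)).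
assert (En : IZR n = IZR N * d + j).
{ unfold d, j; rewrite <- mult_IZR, <- plus_IZR; f_equal; apply Z.div_mod; lia. }
assert (Hj : 0 <= j <= IZR N).
{ unfold j; split; apply IZR_le; pose proof (Z.mod_pos_bound n N); lia. }
set (r := x - IZR n * theta).
assert (Hr : 0 <= r <= 1) by (unfold r; lra).
assert (Ed : d * a = r - z) by (unfold z, b, r, d; ring).
assert (Ex : x = j * theta + d * (1 - a) + r).
{ unfold r; rewrite En, <- Hone; ring. }
pose proof (Rabs_pos z) as Hz; pose proof (Rabs_pos d) as Hd0.
assert (Hd : Rabs d <= (1 + Rabs z) * (1 / a)).
{ apply Rmult_le_reg_r with a; [lra|].
  replace ((1 + Rabs z) * (1 / a) * a) with (1 + Rabs z) by (field; lra).
  rewrite <- (Rabs_pos_eq a) at 1 by lra; rewrite <- Rabs_mult, Ed.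
  unfold Rminus; apply Rle_trans with (1 := Rabs_triang _ _).
  rewrite Rabs_Ropp, (Rabs_pos_eq r) by lra; lra. }
assert (Hx : Rabs x <= IZR N + Rabs d + 1).
{ assert (0 <= j * theta <= IZR N).
  { split; [apply Rmult_le_pos; lra|].
    rewrite <- (Rmult_1_r (IZR N)); apply Rmult_le_compat; lra. }
  assert (Hd1 : Rabs (d * (1 - a)) <= Rabs d).
  { rewrite Rabs_mult, (Rabs_pos_eq (1 - a)) by lra.
    rewrite <- (Rmult_1_r (Rabs d)) at 2; apply Rmult_le_compat_l; lra. }
  apply Rabs_le_between in Hd1; apply Rabs_le; lra. }
unfold wt.
assert (0 <= IZR N * Rabs z) by (apply Rmult_le_pos; lra).
lra.
Qed.

(** With [x] the first of the two glued points, the second is [x + 1], and the potential is their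
    mean [al^2 x + be^2 (x + 1) = x + 1 - f]. *)
Definition potential_piece (n m : Z) (y : R) : R :=
  y + (IZR n * theta + 1 - IZR m) + (-1) * f (y + - (IZR m * a)).

Definition potential (n : Z) : R -> R := glue a (potential_piece n).

Lemma potential_at (n m : Z) (r : R) :
  0 <= r < a ->
  potential n (r + IZR m * a) = r + IZR (n - m * N) * theta + 1 - f r.
Proof.
intros Hr; unfold potential; rewrite (glue_cell a _ m) by lra.
unfold potential_piece; rewrite minus_IZR, mult_IZR.
replace (r + IZR m * a + - (IZR m * a)) with r by ring.
assert (E : IZR m * a = IZR m - IZR m * IZR N * theta).
{ replace (IZR m - IZR m * IZR N * theta) with (IZR m * (1 - IZR N * theta)) by ring.
  rewrite <- (rs_one _ _ _ _ _ _ RS); ring. }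
rewrite E; ring.
Qed.

Lemma potential_equivariant : equivariant a N potential.
Proof.
intros n m y; destruct (reduce_mod_a y) as [k [r [-> Hr]]].
rewrite potential_at by exact Hr.
replace (r + IZR k * a + IZR m * a) with (r + IZR (k + m) * a) by (rewrite plus_IZR; ring).
rewrite potential_at by exact Hr.
replace (n - m * N - k * N)%Z with (n - (k + m) * N)%Z by ring; reflexivity.
Qed.

Lemma potential_piece_agree (n : Z) : agree a (potential_piece n).
Proof.
pose proof margin_spec; exists margin; split; [lra|]; intros m x Hx.
unfold potential_piece; rewrite !minus_IZR.
replace (x + - ((IZR m - 1) * a)) with (x + - (IZR m * a) + a) by ring.
rewrite f_flip by (pose proof (rs_eps _ _ _ _ _ _ RS); lra).
rewrite (f_left (x + - (IZR m * a))) by lra; ring.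
Qed.

(** On cell [m] one has [Rabs (IZR m) <= (1 + Rabs y) / a], so the offset between [y] and the real
    line grows linearly, while the term with [f] is bounded. *)
Lemma potential_tempered (k : nat) (n : Z) :
  tempered (I := unit) everywhere 1 k (fun _ => potential n).
Proof.
pose proof a_bounds as Ha.
apply glue_tempered; [lra | apply potential_piece_agree|].
apply tempered_plus; [apply tempered_plus; [apply tempered_id|]|].
- destruct k; split.
  1,3: exists (Rabs (IZR n * theta) + 3 + 1 / a);
    assert (0 < 1 / a) by (apply Rdiv_lt_0_compat; lra);
    pose proof (Rabs_pos (IZR n * theta)); split; [lra|]; intros m y [H1 H2].
  1,2: assert (Hm : Rabs (IZR m) <= (1 + Rabs y) * (1 / a)).
  1,3: apply Rmult_le_reg_r with a; [lra|];
    replace ((1 + Rabs y) * (1 / a) * a) with (1 + Rabs y) by (field; lra);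
    rewrite <- (Rabs_pos_eq a) at 1 by lra; rewrite <- Rabs_mult;
    pose proof (Rle_abs y); pose proof (Rle_abs (- y)); rewrite Rabs_Ropp in *;
    apply Rabs_le; lra.
  1,2: rewrite pow_1; unfold wt; pose proof (Rabs_pos y);
    replace (IZR n * theta + 1 - IZR m) with ((IZR n * theta + 1) + - IZR m) by ring;
    apply Rle_trans with (1 := Rabs_triang _ _); rewrite Rabs_Ropp;
    pose proof (Rabs_triang (IZR n * theta) 1); rewrite Rabs_R1 in *;
    assert (0 <= Rabs (IZR n * theta) * Rabs y) by (apply Rmult_le_pos; lra); lra.
  + exact Logic.I.
  + exists (fun _ _ => 0); split; [intros; apply is_derive_const_R|].
    apply (tempered_const _ 1 k (fun _ => 0) 0); intros; rewrite Rabs_R0; lra.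
- apply (tempered_mono (cell a) 0); [lia|]; apply tempered_mult.
  + apply (tempered_const _ 0 k (fun _ => -1) 1); intros; rewrite Rabs_left by lra; lra.
  + apply (tempered_reindex (cell a) k (fun _ => f) (fun _ => tt) (fun m => - (IZR m * a))).
    apply f_tempered.
Qed.

Lemma potential_continuous (n : Z) (y : R) : continuous (potential n) y.
Proof.
destruct (potential_tempered 1 n) as [_ [h [H _]]].
apply (ex_derive_continuous (potential n)); exists (h tt y); apply (H tt).
Qed.

(* The potential has mean slope [1 - 1 / a < 0]. *)
Lemma potential_confining (n : Z) :
  exists Y0, 0 <= Y0 /\ (forall y, Y0 <= y -> potential n y <= -1) /\
    (forall y, y <= - Y0 -> 1 <= potential n y).
Proof.
pose proof a_bounds as Ha; set (c := IZR n * theta).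
assert (Hc0 := Rabs_pos c).
assert (Hf : forall y, exists e, a * potential n y = c * a - y * (1 - a) + e /\ 0 <= e <= 2).
{ intros y; destruct (reduce_mod_a y) as [m [r [-> Hr]]].
  rewrite potential_at by exact Hr; pose proof (rs_f01 _ _ _ _ _ _ RS r) as H01.
  (* Multiplying by [a] and substituting [N theta = 1 - a] and [m a = y - r] isolates the linear
     term; this bounded remainder is what is left. *)
  exists (r + a * (1 - f r)); split.
  - rewrite minus_IZR, mult_IZR; fold c.
    replace (1 - a) with (IZR N * theta) by (rewrite <- (rs_one _ _ _ _ _ _ RS); ring).
    assert (E : r * (IZR N * theta + a) = r) by (rewrite (rs_one _ _ _ _ _ _ RS); ring).
    rewrite Rmult_minus_distr_r; fold c; rewrite <- E at 4; ring.
  - assert (0 <= a * (1 - f r) <= 1); [|lra].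
    split; [apply Rmult_le_pos; lra|].
    rewrite <- (Rmult_1_l 1); apply Rmult_le_compat; lra. }
assert (Hca : Rabs (c * a) <= Rabs c).
{ rewrite Rabs_mult, (Rabs_pos_eq a) by lra.
  rewrite <- (Rmult_1_r (Rabs c)) at 2; apply Rmult_le_compat_l; lra. }
apply Rabs_le_between in Hca.
(* Of the [4], at most [2] is consumed by [e], and what remains exceeds [a]; division by [a] then
   gives the bounds [-1] and [1]. *)
set (Y0 := (Rabs c + 4) / (1 - a)).
assert (HY : Y0 * (1 - a) = Rabs c + 4) by (unfold Y0; field; lra).
exists Y0; split; [|split].
- apply Rmult_le_pos; [lra|]; left; apply Rinv_0_lt_compat; lra.
- intros y Hy; destruct (Hf y) as [e [E He]].
  assert (Y0 * (1 - a) <= y * (1 - a)) by (apply Rmult_le_compat_r; lra).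
  apply Rmult_le_reg_l with a; lra.
- intros y Hy; destruct (Hf y) as [e [E He]].
  assert (Y0 * (1 - a) <= - y * (1 - a)) by (apply Rmult_le_compat_r; lra).
  apply Rmult_le_reg_l with a; lra.
Qed.

(** * Conjugation of [x + d/dx] *)

Lemma al_is_derive (x : R) : is_derive al x (Derive al x) /\ is_derive be x (Derive be x).
Proof.
destruct (al_be_tempered 1) as [[_ [h [H _]]] [_ [h' [H' _]]]].
split; apply Derive_correct; eexists; [apply (H tt) | apply (H' tt)].
Qed.

Lemma Derive_al_periodic (k : Z) (x : R) : Derive al (x + IZR k * theta) = Derive al x.
Proof.
symmetry; apply is_derive_unique.
apply (is_derive_ext (fun t => al (t + IZR k * theta))); [intros t; apply al_periodic|].
apply is_derive_shift, al_is_derive.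
Qed.

Lemma Derive_al_flip (x : R) : 0 <= x <= eps -> Derive al (x + a) = Derive be x.
Proof.
intros Hx; pose proof margin_spec; symmetry; apply is_derive_unique.
apply (is_derive_ext_loc (fun t => al (t + a))); [|apply is_derive_shift, al_is_derive].
apply (locally_Ioo x (- margin) (eps + margin)); [lra|].
intros t Ht; apply al_flip; lra.
Qed.

Lemma al_Derive_al (x : R) : al x * Derive al x + be x * Derive be x = 0.
Proof.
destruct (al_is_derive x) as [H1 H2].
assert (H : is_derive (fun t => al t * al t + be t * be t) x
  ((Derive al x * al x + al x * Derive al x) + (Derive be x * be x + be x * Derive be x))).
{ apply (is_derive_plus (fun t => al t * al t) (fun t => be t * be t)).
  - apply (is_derive_mult al al); auto; intros; apply Rmult_comm.
  - apply (is_derive_mult be be); auto; intros; apply Rmult_comm. }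
apply is_derive_unique in H.
assert (H' : is_derive (fun t => al t * al t + be t * be t) x 0).
{ apply (is_derive_ext (fun _ => 1)); [|apply is_derive_const_R].
  intros t; destruct (al_be_sqr t) as [E1 E2]; rewrite E1, E2; simpl; lra. }
apply is_derive_unique in H'; rewrite H' in H; lra.
Qed.

Lemma annihilation_unchain_at (s s' : Z -> R -> C) (k : Z) (r : R) :
  (forall n y, cder (s n) y (s' n y)) -> 0 <= r < theta ->
  annihilation (unchain s) (r + IZR k * theta) =
    Cplus (Cmult (RtoC (r + IZR k * theta)) (Cmult (RtoC (al r)) (s k r)))
      (Cplus (Cmult (RtoC (Derive al r)) (s k r)) (Cmult (RtoC (al r)) (s' k r))).
Proof.
intros Hs Hr; unfold annihilation; rewrite unchain_at by exact Hr; f_equal.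
set (G := fun (m : Z) (t : R) => Cplus (Cmult (RtoC (Derive al t)) (s m (t + - (IZR m * theta))))
  (Cmult (RtoC (al t)) (s' m (t + - (IZR m * theta))))).
pose proof (rs_theta _ _ _ _ _ _ RS).
rewrite (cder_CDerive _ _ (glue theta G (r + IZR k * theta))).
- rewrite (glue_cell theta G k) by lra; unfold G.
  rewrite Derive_al_periodic, al_periodic.
  replace (r + IZR k * theta + - (IZR k * theta)) with r by ring; reflexivity.
- apply glue_cder; [lra | apply unchain_piece_agree|]; intros m t.
  apply (cder_rmult al (fun x => s m (x + - (IZR m * theta)))); [apply al_is_derive|].
  apply (cder_shift (s m)), Hs.
Qed.

(* The first order term of [T* (x + d/dx) T], [T = unchain], is [d/dy] because
   [al al' + be be' = 0]. *)
Lemma chain_annihilation_unchain (s s' : Z -> R -> C) (n : Z) (y : R) :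
  equivariant a N s -> (forall n y, cder (s n) y (s' n y)) ->
  chain (annihilation (unchain s)) n y =
    Cplus (s' n y) (Cmult (RtoC (potential n y)) (s n y)).
Proof.
intros He Hs; destruct (reduce_mod_a y) as [m [r [-> Hr]]].
rewrite chain_at, potential_at by exact Hr.
pose proof (equivariant_cder a N s s' He Hs) as Hd.
rewrite <- (He n m r), <- (Hd n m r).
set (k := (n - m * N)%Z).
pose proof (rs_a _ _ _ _ _ _ RS); pose proof (rs_eps _ _ _ _ _ _ RS); pose proof margin_spec.
rewrite (annihilation_unchain_at s s') by (exact Hs || lra).
destruct (al_be_sqr r) as [E1 E2]; pose proof (al_Derive_al r) as E3.
destruct (Rle_dec r eps) as [C1|C1].
- rewrite add_one_eq, (annihilation_unchain_at s s') by (exact Hs || lra).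
  rewrite (equivariant_add s k r He), (equivariant_add s' k r Hd).
  rewrite <- add_one_eq.
  destruct (al_flip r) as [-> _]; [lra|]; rewrite Derive_al_flip by lra.
  set (x := r + IZR k * theta).
  set (A := al r) in *; set (B := be r) in *.
  set (A' := Derive al r) in *; set (B' := Derive be r) in *.
  (* The terms regroup as [(A^2 + B^2) (v + x u) + B^2 u + (A A' + B B') u]. The first bracket is
     [1], the last is [0], and [B^2 = 1 - f r] comes from the second point being [x + 1]. *)
  assert (E : forall u v : R,
    A * (x * (A * u) + (A' * u + A * v)) + B * ((x + 1) * (B * u) + (B' * u + B * v)) =
    v + (x + 1 - f r) * u).
  { intros u v.
    transitivity ((A * A + B * B) * (v + x * u) + (B * B) * u + (A * A' + B * B') * u);
      [ring|].
    rewrite E3, E1, E2; ring. }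
  destruct (s k r) as [u1 u2], (s' k r) as [v1 v2].
  apply injective_projections; unfold Cplus, Cmult, RtoC; simpl;
    [ transitivity (v1 + (x + 1 - f r) * u1); [rewrite <- E|]
    | transitivity (v2 + (x + 1 - f r) * u2); [rewrite <- E|] ]; ring.
- destruct (al_mid r) as [Ea Eb]; [lra|].
  rewrite Ea, Eb in *; replace (Derive al r) with 0 by lra.
  rewrite (rs_f1 _ _ _ _ _ _ RS) by lra.
  replace (r + IZR k * theta + 1 - 1) with (r + IZR k * theta) by ring; ring.
Qed.

(** * The compressed operator on the chains *)

Lemma unchain_eq (s s' : Z -> R -> C) :
  (forall n y, s n y = s' n y) -> unchain s = unchain s'.
Proof.
intros H; replace s' with s; [reflexivity|].
extensionality n; extensionality y; apply H.
Qed.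

Lemma rieffel_op_fixes_unchain (s : Z -> R -> C) :
  equivariant a N s -> rieffel_op f g (unchain s) = unchain s.
Proof.
intros Hs; extensionality x; rewrite rieffel_op_unchain_chain.
rewrite (unchain_eq (chain (unchain s)) s); [reflexivity|].
intros n y; apply chain_unchain, Hs.
Qed.

Lemma unchain_injective (s s' : Z -> R -> C) :
  equivariant a N s -> equivariant a N s' -> (forall x, unchain s x = unchain s' x) ->
  forall n y, s n y = s' n y.
Proof.
intros Hs Hs' H n y.
assert (E : unchain s = unchain s') by (extensionality x; apply H).
rewrite <- (chain_unchain s), <- (chain_unchain s'), E by assumption; reflexivity.
Qed.

Lemma image_unchain (phi : R -> C) :
  image schwartz (rieffel_op f g) phi ->
  exists s, equivariant a N s /\ (forall k j, rapid k (s j)) /\ phi = unchain s.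
Proof.
intros [phi0 [H0 H]]; exists (chain phi0); split; [apply chain_equivariant | split].
- intros k j; apply chain_rapid, schwartz_rapid, H0.
- extensionality x; rewrite H; apply rieffel_op_unchain_chain.
Qed.

Lemma unchain_image (s : Z -> R -> C) :
  equivariant a N s -> (forall k j, rapid k (s j)) ->
  image schwartz (rieffel_op f g) (unchain s).
Proof.
intros He Hs; exists (unchain s); split.
- apply schwartz_rapid; intros k; apply unchain_rapid; auto.
- intros x; rewrite (rieffel_op_fixes_unchain s He); reflexivity.
Qed.

Lemma compressed_unchain (s s' : Z -> R -> C) :
  equivariant a N s -> (forall n y, cder (s n) y (s' n y)) ->
  compressed (rieffel_op f g) (unchain s) =
    unchain (fun n y => Cplus (s' n y) (Cmult (RtoC (potential n y)) (s n y))).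
Proof.
intros He Hs; unfold compressed; rewrite (rieffel_op_fixes_unchain s He).
extensionality x; rewrite rieffel_op_unchain_chain.
rewrite (unchain_eq _ (fun n y => Cplus (s' n y) (Cmult (RtoC (potential n y)) (s n y))));
  [reflexivity|].
intros n y; apply chain_annihilation_unchain; assumption.
Qed.

(** The members numbered [0] to [N - 1] of an equivariant family are arbitrary and determine the
    rest through [n = n mod N + (n / N) N]; this rebuilds the family from them. *)
Definition spread {V : Type} (sigma : nat -> R -> V) (n : Z) (y : R) : V :=
  sigma (Z.to_nat (n mod N)) (y + - (IZR (n / N) * a)).

Lemma spread_equivariant {V : Type} (sigma : nat -> R -> V) : equivariant a N (spread sigma).
Proof.
intros n m y; pose proof (rs_N _ _ _ _ _ _ RS); unfold spread.
replace (n - m * N)%Z with (n + (- m) * N)%Z by ring.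
rewrite Z.mod_add, Z.div_add by lia; f_equal; rewrite plus_IZR, opp_IZR; ring.
Qed.

Lemma spread_at {V : Type} (sigma : nat -> R -> V) (j : nat) (y : R) :
  (j < Z.to_nat N)%nat -> spread sigma (Z.of_nat j) y = sigma j y.
Proof.
intros Hj; pose proof (rs_N _ _ _ _ _ _ RS); unfold spread.
rewrite Z.mod_small, Z.div_small, Nat2Z.id by lia; f_equal; simpl; ring.
Qed.

Lemma equivariant_spread {V : Type} (s : Z -> R -> V) (n : Z) (y : R) :
  equivariant a N s -> s n y = spread (fun j => s (Z.of_nat j)) n y.
Proof.
intros Hs; pose proof (rs_N _ _ _ _ _ _ RS); unfold spread.
rewrite Z2Nat.id by (apply Z.mod_pos_bound; lia).
replace (n mod N)%Z with (n - (n / N) * N)%Z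
  by (rewrite (Z.div_mod n N) at 1 by lia; ring).
rewrite Hs; f_equal; ring.
Qed.

Lemma spread_rapid (k : nat) (sigma : nat -> R -> C) (n : Z) :
  (forall j, rapid k (sigma j)) -> rapid k (spread sigma n).
Proof.
intros H; set (b := - (IZR (n / N) * a)).
apply (decaying_reindex everywhere everywhere (fun _ => 1) k
  (fun _ : unit => sigma (Z.to_nat (n mod N))) (fun u => u) (fun _ => b) (1 + Rabs b));
  [pose proof (Rabs_pos b); lra | | apply H].
intros M j x _; split; [exact Logic.I|]; unfold wt.
assert (Rabs x <= Rabs (x + b) + Rabs b).
{ replace x with ((x + b) + - b) at 1 by ring.
  apply Rle_trans with (1 := Rabs_triang _ _); rewrite Rabs_Ropp; lra. }
pose proof (Rabs_pos b); pose proof (Rabs_pos (x + b)).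
assert (0 <= Rabs b * Rabs (x + b)) by (apply Rmult_le_pos; lra); lra.
Qed.

Lemma spread_cder (sigma sigma' : nat -> R -> C) (n : Z) (y : R) :
  (forall j y, cder (sigma j) y (sigma' j y)) ->
  cder (spread sigma n) y (spread sigma' n y).
Proof. intros H; apply (cder_shift (sigma (Z.to_nat (n mod N)))), H. Qed.

(** * Integrating factors, kernel and cokernel *)

Definition weight (j : nat) : R -> R := exp_primitive (potential (Z.of_nat j)).

Lemma weight_integrating (j : nat) :
  exists Y0, integrating_factor (potential (Z.of_nat j)) (weight j) Y0.
Proof.
destruct (potential_confining (Z.of_nat j)) as [Y0 [H0 [H1 H2]]]; exists Y0.
apply exp_primitive_integrating; auto; apply potential_continuous.
Qed.

Lemma weight_rapid (j k : nat) : rapid k (fun y => RtoC (weight j y)).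
Proof.
destruct (weight_integrating j) as [Y0 H].
apply (integrating_factor_schwartz _ _ Y0 1 H); intros n; apply potential_tempered.
Qed.

(** For rapidly decaying [s] the integral of [w (s' + X s) = (s w)'] is zero, so [w] is orthogonal
    to the range on its own line but not to itself: the natural generator of a complement. *)
Definition coker_basis (j : nat) : R -> C :=
  unchain (spread (fun i y => if Nat.eqb i j then RtoC (weight j y) else RtoC 0)).

Lemma lincomb_delta (M i : nat) (c : nat -> C) (e : nat -> R -> C) (v : C) (x : R) :
  (forall j, e j x = if Nat.eqb i j then v else RtoC 0) ->
  lincomb M c e x = if Nat.ltb i M then Cmult (c i) v else RtoC 0.
Proof.
intros He; induction M as [|M IH]; [reflexivity|].
simpl lincomb; rewrite IH, He.
destruct (Nat.eqb_spec i M) as [->|Hne].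
- rewrite (proj2 (Nat.ltb_ge M M)), (proj2 (Nat.ltb_lt M (S M))) by lia; ring.
- destruct (Nat.ltb_spec i M), (Nat.ltb_spec i (S M)); try lia; ring.
Qed.

Lemma lincomb_coker_basis (c : nat -> C) :
  lincomb (Z.to_nat N) c coker_basis =
  unchain (spread (fun i y => Cmult (c i) (RtoC (weight i y)))).
Proof.
pose proof (rs_N _ _ _ _ _ _ RS).
extensionality x; set (n := fl theta x); set (i := Z.to_nat (n mod N)).
set (z := x + - (IZR n * theta) + - (IZR (n / N) * a)).
(* At a fixed [x] a single line [i] and a single coordinate [z] are involved, so the sum over the
   basis collapses to one term. *)
assert (E : forall sigma, unchain (spread sigma) x = Cmult (RtoC (al x)) (sigma i z))
  by reflexivity.
rewrite (lincomb_delta _ i _ _ (Cmult (RtoC (al x)) (RtoC (weight i z)))).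
- rewrite (proj2 (Nat.ltb_lt _ _)), E; [ring|].
  unfold i; apply Z2Nat.inj_lt; [| lia |]; apply Z.mod_pos_bound; lia.
- intros j; unfold coker_basis; rewrite E.
  destruct (Nat.eqb_spec i j) as [->|]; ring.
Qed.

Lemma coker_basis_image (j : nat) : image schwartz (rieffel_op f g) (coker_basis j).
Proof.
apply unchain_image; [apply spread_equivariant|].
intros k n; apply spread_rapid; intros i.
destruct (Nat.eqb_spec i j); [apply weight_rapid|].
apply rapid_zero.
Qed.

(** Injectivity of [unchain] turns [D phi = 0] into the homogeneous equation on every line, and the
    uniqueness statement applies with [c = 0]. *)
Lemma kernel_trivial (phi : R -> C) :
  kernel (image schwartz (rieffel_op f g)) (compressed (rieffel_op f g)) phi ->
  forall x, phi x = RtoC 0.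
Proof.
intros [Hphi HD]; destruct (image_unchain phi Hphi) as [s [He [Hs ->]]].
set (s' := fun n => CDerive (s n)).
assert (Hs' : forall n y, cder (s n) y (s' n y)).
{ intros n; apply (rapid_cder 0), Hs. }
rewrite (compressed_unchain s s' He Hs') in HD.
pose proof (equivariant_cder a N s s' He Hs') as Hd.
assert (H0 : forall n y, Cplus (s' n y) (Cmult (RtoC (potential n y)) (s n y)) = RtoC 0).
{ apply (unchain_injective _ (fun _ _ => RtoC 0)).
  - intros n m y; rewrite Hd, He, potential_equivariant; reflexivity.
  - intros n m y; reflexivity.
  - intros x; rewrite HD; unfold unchain, glue, unchain_piece; ring. }
assert (Hz : forall n y, s n y = RtoC 0).
{ intros n y; rewrite (equivariant_spread s n y He); unfold spread.
  set (j := Z.to_nat (n mod N)); destruct (weight_integrating j) as [Y0 HI].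
  apply (ode_unique_C _ _ _ (RtoC 0) (s (Z.of_nat j)) HI); [|apply Hs].
  intros t; replace (Cminus _ _) with (s' (Z.of_nat j) t); [apply Hs'|].
  specialize (H0 (Z.of_nat j) t).
  replace (s' (Z.of_nat j) t) with (Cminus (Cplus (s' (Z.of_nat j) t)
    (Cmult (RtoC (potential (Z.of_nat j) t)) (s (Z.of_nat j) t)))
    (Cmult (RtoC (potential (Z.of_nat j) t)) (s (Z.of_nat j) t))) by ring.
  rewrite H0; ring. }
intros x; unfold unchain, glue, unchain_piece; rewrite Hz; ring.
Qed.

(** On line [j] the equation [s' + X s = h - c w] is solvable for a suitable scalar. The scalars are
    the coefficients on the basis, and the solutions, spread to an equivariant family, form the
    preimage. *)
Lemma image_complement (phi : R -> C) :
  image schwartz (rieffel_op f g) phi ->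
  exists c, image (image schwartz (rieffel_op f g)) (compressed (rieffel_op f g))
    (fun x => Cminus (phi x) (lincomb (Z.to_nat N) c coker_basis x)).
Proof.
intros Hphi; destruct (image_unchain phi Hphi) as [h [He [Hh ->]]].
assert (Hsol : forall j : nat, exists p : C * (R -> C),
  (forall y, cder (snd p) y (Cminus (Cminus (h (Z.of_nat j) y)
     (Cmult (fst p) (RtoC (weight j y)))) (Cmult (RtoC (potential (Z.of_nat j) y)) (snd p y))))
  /\ rapid 0 (snd p)).
{ intros j; destruct (weight_integrating j) as [Y0 HI].
  destruct (ode_solvable_C _ _ Y0 (h (Z.of_nat j)) HI (Hh 1%nat _)) as [c [s H]].
  exists (c, s); exact H. }
(* Scalar and solution are chosen together, so that both become functions of [j] tied by the same
   equation. *)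
set (p := fun j => proj1_sig (constructive_indefinite_description _ (Hsol j))).
assert (Hp := fun j => proj2_sig (constructive_indefinite_description _ (Hsol j))).
change (forall j,
  (forall y, cder (snd (p j)) y (Cminus (Cminus (h (Z.of_nat j) y)
     (Cmult (fst (p j)) (RtoC (weight j y))))
     (Cmult (RtoC (potential (Z.of_nat j) y)) (snd (p j) y))))
  /\ rapid 0 (snd (p j))) in Hp.
set (k := fun j y => Cminus (h (Z.of_nat j) y) (Cmult (fst (p j)) (RtoC (weight j y)))).
assert (Hk : forall j n, rapid n (k j)).
{ intros j n; unfold k.
  replace (fun y => Cminus (h (Z.of_nat j) y) (Cmult (fst (p j)) (RtoC (weight j y)))) with
    (fun y => Cplus (h (Z.of_nat j) y) (Cmult (- fst (p j))%C (RtoC (weight j y))))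
    by (extensionality y; ring).
  apply decaying_plus; [apply antitone_everywhere | apply Hh | apply decaying_cmult, weight_rapid]. }
set (sigma := fun j => snd (p j)).
assert (Hsigma : forall j n, rapid n (sigma j)).
{ intros j; destruct (Hp j) as [H1 H2].
  apply (ode_regular (potential (Z.of_nat j)) 1 (k j)); auto.
  intros n; apply potential_tempered. }
exists (fun j => fst (p j)), (unchain (spread sigma)); split.
- apply unchain_image; [apply spread_equivariant|].
  intros n j; apply spread_rapid; auto.
- intros x.
  rewrite (compressed_unchain _ (spread (fun j y =>
    Cminus (k j y) (Cmult (RtoC (potential (Z.of_nat j) y)) (sigma j y)))));
    [| apply spread_equivariant | intros n y; apply spread_cder; intros j t; apply Hp].
  rewrite lincomb_coker_basis.
  rewrite (unchain_eq h (spread (fun j => h (Z.of_nat j))))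
    by (intros; apply equivariant_spread, He).
  rewrite (unchain_eq (fun n y => Cplus _ _) (spread k)).
  + unfold unchain, glue, unchain_piece, spread, k; ring.
  + intros n y; rewrite (equivariant_spread potential n y potential_equivariant).
    unfold spread; ring.
Qed.

(** On line [i] a relation modulo the range reads [s' + X s = c i w] with [s] rapidly decaying,
    which forces [c i = 0]. *)
Lemma coker_basis_independent (c : nat -> C) :
  image (image schwartz (rieffel_op f g)) (compressed (rieffel_op f g))
    (lincomb (Z.to_nat N) c coker_basis) ->
  forall i, (i < Z.to_nat N)%nat -> c i = RtoC 0.
Proof.
intros [phi [Hphi HD]] i Hi; destruct (image_unchain phi Hphi) as [s [He [Hs ->]]].
set (s' := fun n => CDerive (s n)).
assert (Hs' : forall n y, cder (s n) y (s' n y)).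
{ intros n; apply (rapid_cder 0), Hs. }
rewrite (compressed_unchain s s' He Hs'), lincomb_coker_basis in HD.
pose proof (equivariant_cder a N s s' He Hs') as Hd.
destruct (weight_integrating i) as [Y0 HI].
apply (ode_unique_C _ _ _ (c i) (s (Z.of_nat i)) HI); [|apply Hs].
intros t; replace (Cminus _ _) with (s' (Z.of_nat i) t); [apply Hs'|].
assert (Hr : equivariant a N (fun n y => Cplus (s' n y) (Cmult (RtoC (potential n y)) (s n y)))).
{ intros n m y; rewrite Hd, He, potential_equivariant; reflexivity. }
pose proof (unchain_injective _ _ (spread_equivariant _) Hr HD (Z.of_nat i) t) as E.
rewrite spread_at in E by exact Hi; cbv beta in E; rewrite E; ring.
Qed.

(** * Mapping properties and continuity on the Schwartz space *)

Lemma decaying_rieffel_op {I : Type} (S : nat -> I -> R -> Prop) (nu : I -> R) n F :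
  antitone S -> (forall M i x y, S M i x -> S M i y) ->
  decaying S nu n F -> decaying S nu n (fun i => rieffel_op f g (F i)).
Proof.
intros HS Hx HF.
(* The regions must not depend on the point, because [P] translates by [1]; such a translation
   changes the weight by a factor of at most [2]. *)
assert (Hsh : forall b, Rabs b <= 1 -> decaying S nu n (fun i x => F i (x + b))).
{ intros b Hb.
  apply (decaying_reindex S S nu n F (fun i => i) (fun _ => b) 2); [lra | | exact HF].
  intros M i x Hi; split; [apply (Hx _ _ _ _ Hi)|]; unfold wt.
  assert (Rabs x <= Rabs (x + b) + Rabs b); [|pose proof (Rabs_pos (x + b)); lra].
  replace x with ((x + b) + - b) at 1 by ring.
  apply Rle_trans with (1 := Rabs_triang _ _); rewrite Rabs_Ropp; lra. }
assert (Ht : forall h b, (forall n, tempered (I := unit) everywhere 0 n (fun _ => h)) ->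
  tempered S 0 n (fun (_ : I) x => h (x + b))).
{ intros h b Hh.
  apply (tempered_reindex S n (fun _ => h) (fun _ => tt) (fun _ => b)), Hh. }
replace (fun i => rieffel_op f g (F i)) with
  (fun i x => Cplus (Cplus (Cmult (RtoC (g (x + -1))) (F i (x + -1)))
                           (Cmult (RtoC (f (x + 0))) (F i (x + 0))))
                    (Cmult (RtoC (g (x + 0))) (F i (x + 1)))).
- apply decaying_plus; [exact HS | apply decaying_plus; [exact HS| |] |];
    apply (decaying_mult S nu HS 0); try (apply Hsh; apply Rabs_le; lra);
    apply Ht; intros m; (apply f_tempered || apply g_tempered).
- extensionality i; extensionality x; unfold rieffel_op, Uinv, U, mult_by.
  replace (x + -1) with (x - 1) by ring; rewrite Rplus_0_r; reflexivity.
Qed.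

Lemma decaying_compressed {I : Type} (S : nat -> I -> R -> Prop) (nu : I -> R) n F :
  antitone S -> (forall M i x y, S M i x -> S M i y) ->
  decaying S nu (Datatypes.S n) F ->
  decaying S nu n (fun i => annihilation (rieffel_op f g (F i))) /\
  decaying S nu n (fun i => compressed (rieffel_op f g) (F i)).
Proof.
intros HS Hx HF; assert (HA : decaying S nu n (fun i => annihilation (rieffel_op f g (F i)))).
{ apply decaying_annihilation, decaying_rieffel_op; assumption. }
split; [exact HA|].
apply (decaying_rieffel_op S nu n (fun i => annihilation (rieffel_op f g (F i)))); assumption.
Qed.

Lemma schwartz_rieffel_op (phi : R -> C) : schwartz phi -> schwartz (rieffel_op f g phi).
Proof.
intros H; apply schwartz_rapid; intros n.
apply (decaying_rieffel_op everywhere (fun _ => 1) n (fun _ : unit => phi)).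
- apply antitone_everywhere.
- intros; exact Logic.I.
- apply schwartz_rapid, H.
Qed.

Lemma schwartz_image (phi : R -> C) : image schwartz (rieffel_op f g) phi -> schwartz phi.
Proof.
intros [phi0 [H0 H]]; replace phi with (rieffel_op f g phi0).
- apply schwartz_rieffel_op, H0.
- extensionality x; symmetry; apply H.
Qed.

Lemma compressed_maps (phi : R -> C) :
  image schwartz (rieffel_op f g) phi ->
  image schwartz (rieffel_op f g) (compressed (rieffel_op f g) phi).
Proof.
intros Hphi; exists (annihilation (rieffel_op f g phi)); split; [|reflexivity].
apply schwartz_rapid; intros n.
apply (decaying_compressed everywhere (fun _ => 1) n (fun _ : unit => phi)).
- apply antitone_everywhere.
- intros; exact Logic.I.
- apply schwartz_rapid, schwartz_image, Hphi.
Qed.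

Lemma compressed_linear :
  linear_on (image schwartz (rieffel_op f g)) (compressed (rieffel_op f g)).
Proof.
intros c phi psi Hphi Hpsi x.
assert (HP : forall u v, rieffel_op f g (fun t => Cplus (Cmult c (u t)) (v t)) =
  (fun t => Cplus (Cmult c (rieffel_op f g u t)) (rieffel_op f g v t))).
{ intros u v; extensionality t; unfold rieffel_op, Uinv, U, mult_by; ring. }
assert (Hd : forall u, schwartz u -> forall t, cder u t (CDerive u t)).
{ intros u [Hu _] t; apply ex_derive_cder, (Hu 0%nat). }
unfold compressed; rewrite HP.
replace (annihilation _) with
  (fun t => Cplus (Cmult c (annihilation (rieffel_op f g phi) t))
                  (annihilation (rieffel_op f g psi) t)); [rewrite HP; reflexivity|].
extensionality t; unfold annihilation.
rewrite (cder_CDerive (fun t => Cplus (Cmult c (rieffel_op f g phi t)) (rieffel_op f g psi t)) t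
  (Cplus (Cmult c (CDerive (rieffel_op f g phi) t)) (CDerive (rieffel_op f g psi) t))); [ring|].
apply cder_plus; [apply cder_cmult|]; apply Hd, schwartz_rieffel_op, schwartz_image; assumption.
Qed.

Lemma compressed_continuous :
  continuous_on_schwartz (image schwartz (rieffel_op f g)) (compressed (rieffel_op f g)).
Proof.
(* An index is a Schwartz function with a number [B], and level [M] says that [B] bounds its
   seminorms up to order [M]. With [nu = snd], decay of the images is then exactly a seminorm
   estimate proportional to [B]. *)
set (S := fun (M : nat) (i : {phi | schwartz phi} * R) (_ : R) =>
  forall k n, (k <= M)%nat -> (n <= M)%nat -> seminorm_le k n (proj1_sig (fst i)) (snd i)).
set (F := fun i : {phi | schwartz phi} * R => proj1_sig (fst i)).
assert (HS : antitone S).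
{ intros M M' i x HM H k n Hk Hn; apply H; lia. }
assert (HF : forall n, decaying S snd n F).
{ apply decaying_seminorms; [exact HS | |].
  - intros i; exact (proj1 (proj2_sig (fst i))).
  - intros k n; exists 1, (Nat.max k n); intros i x Hi; rewrite Rmult_1_l; apply Hi; lia. }
intros k n.
assert (HD : decaying S snd (n + 0) (fun i => compressed (rieffel_op f g) (F i))).
{ apply decaying_compressed; [exact HS | intros M i x y H; exact H | apply HF]. }
apply decaying_CDerive_n in HD; destruct HD as [HD _]; destruct (HD k) as [K [M HK]].
exists K, M; intros phi B Hphi HB x.
specialize (HK (exist _ phi (schwartz_image phi Hphi), B) x HB); simpl in HK.
apply Rle_trans with (2 := HK), Rmult_le_compat_r; [apply Cmod_ge_0|].
apply pow_incr; unfold wt; pose proof (Rabs_pos x); lra.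
Qed.

Lemma compressed_ker_dim :
  ker_dim (image schwartz (rieffel_op f g)) (compressed (rieffel_op f g)) 0.
Proof.
exists (fun _ _ => RtoC 0); split; [intros i Hi; lia | split; [|intros c _ i Hi; lia]].
intros phi Hphi; exists (fun _ => RtoC 0); intros x; simpl.
rewrite (kernel_trivial phi Hphi x); ring.
Qed.

Lemma compressed_coker_dim :
  coker_dim (image schwartz (rieffel_op f g)) (image schwartz (rieffel_op f g))
    (compressed (rieffel_op f g)) (Z.to_nat N).
Proof.
exists coker_basis; split; [intros i _; apply coker_basis_image | split].
- exact image_complement.
- exact coker_basis_independent.
Qed.

End Chains.

Theorem mainTheorem6 (theta eps : R) (f g : R -> R)
  (Htheta : 0 < theta < 1)
  (Hnonint : forall m : Z, 1 / theta <> IZR m)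
  (Hfg : rieffel_data theta eps f g) :
  let P := rieffel_op f g in
  let PS := image schwartz P in
  let D := compressed P in
  fredholm PS PS D /\
  exists d : Z, has_index PS PS D d /\
    IZR d = frac_part (1 / theta) - 1 / theta /\
    d = (- Int_part (1 / theta))%Z.
Proof.
intros P PS D.
pose proof (rieffel_data_setup theta eps f g Htheta Hfg) as RS.
pose proof (compressed_ker_dim RS) as Hker; pose proof (compressed_coker_dim RS) as Hcoker.
split.
- split; [exact (compressed_maps RS)|].
  split; [exact (compressed_linear RS)|].
  split; [exact (compressed_continuous RS)|].
  split; eexists; [exact Hker | exact Hcoker].
- exists (- Int_part (1 / theta))%Z; split; [|split; [|reflexivity]].
  + exists 0%nat, (Z.to_nat (Int_part (1 / theta))).
    split; [exact Hker | split; [exact Hcoker|]].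
    (* Positivity of the integer part makes its passage through [nat] lossless. *)
    pose proof (rs_N _ _ _ _ _ _ RS); lia.
  + rewrite opp_IZR; unfold frac_part; ring.
Qed.
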